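(* Let $\mathfrak{g}$ be a finite-dimensional complex simple Lie algebra with Cartan subalgebra $\mathfrak{h}$ and root system $\Phi$, and let $\mathfrak{s}_{T,\mathfrak{t}}$ be a regular subalgebra of $\mathfrak{g}$, where $T\subseteq\Phi$ is closed and $\mathfrak{t}\subseteq\mathfrak{h}$ is a subspace containing $[\mathfrak{g}_\alpha,\mathfrak{g}_{-\alpha}]$ for each $\alpha\in T^r$. Then $\mathfrak{s}_{T,\mathfrak{t}}$ is wide if and only if the adjoint representation of $\mathfrak{g}$ is indecomposable when restricted to $\mathfrak{s}_{T,\mathfrak{t}}$.
   Context: All Lie algebras and modules are finite-dimensional over $\mathbb{C}$. $\mathfrak{g}_\alpha$ is the root space of $\alpha\in\Phi$. A subset $T\subseteq\Phi$ is closed if $x,y\in T$ and $x+y\in\Phi$ imply $x+y\in T$. For closed $T$, $T^r=\{\alpha\in T\mid -\alpha\in T\}$. $\mathfrak{s}_{T,\mathfrak{t}} := \mathfrak{t}\oplus\bigoplus_{\alpha\in T}\mathfrak{g}_\alpha$, a subalgebra of $\mathfrak{g}$. (These are exactly the subalgebras of $\mathfrak{g}$ normalized by $\mathfrak{h}$.) A subalgebra $\mathfrak{s}\subseteq\mathfrak{g}$ is wide if every simple $\mathfrak{g}$-module is indecomposable as an $\mathfrak{s}$-module. A module is indecomposable if it is not a direct sum of two nonzero submodules. *)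

(* Defs.v *)
From HB Require Import structures.
From mathcomp Require Import all_boot all_order all_algebra.
From mathcomp Require Import finmap complex reals.

Set Implicit Arguments.
Unset Strict Implicit.
Unset Printing Implicit Defensive.

Import GRing.Theory.
Local Open Scope ring_scope.

HB.mixin Record isLieAlgebra (F : fieldType) g of Vector F g := {
  lie : g -> g -> g;
  lie_linearr : forall x : g, linear (lie x);
  lie_linearl : forall y : g, linear (lie^~ y);
  lie_alt : forall x : g, lie x x = 0;
  lie_jacobi : forall x y z : g,
    lie x (lie y z) + lie y (lie z x) + lie z (lie x y) = 0
}.

(* Finite-dimensional, since it extends vectType. *)
#[short(type="lieAlgType")]
HB.structure Definition LieAlgebra (F : fieldType) :=
  { g of isLieAlgebra F g & Vector F g }.

Section LieAlgebras.

Variables (F : fieldType) (g : lieAlgType F).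
Implicit Types (U V W h s t : {vspace g}) (x y z : g).

HB.instance Definition _ x := GRing.isLinear.Build F g g *:%R (lie x)
  (lie_linearr x).

Lemma lieDl x y z : lie (x + y) z = lie x z + lie y z.
Proof. by have := lie_linearl z 1 x y; rewrite !scale1r. Qed.

Lemma lieDr x y z : lie x (y + z) = lie x y + lie x z.
Proof. exact: raddfD. Qed.

Lemma lie0l z : lie 0 z = 0.
Proof.
by have := lieDl 0 0 z; rewrite addr0 => /eqP; rewrite -subr_eq subrr => /eqP.
Qed.

Lemma lieZl a x z : lie (a *: x) z = a *: lie x z.
Proof. by have := lie_linearl z a x 0; rewrite lie0l !addr0. Qed.

Lemma lieZr a x z : lie x (a *: z) = a *: lie x z.
Proof. exact: linearZ. Qed.

Lemma lie_anti x y : lie x y = - lie y x.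
Proof.
apply/eqP; rewrite -addr_eq0.
by have := lie_alt (x + y); rewrite lieDl !lieDr !lie_alt add0r addr0 => ->.
Qed.

Definition ad x : 'End(g) := linfun (lie x).

Lemma adE x y : ad x y = lie x y.
Proof. exact: lfunE. Qed.

Lemma ad_is_linear : linear ad.
Proof.
move=> a x y; apply/lfunP=> z.
by rewrite add_lfunE scale_lfunE !adE lieDl lieZl.
Qed.

HB.instance Definition _ := GRing.isLinear.Build F g 'End(g) *:%R ad
  ad_is_linear.

(* [U, V], the span of all brackets; see lie_prodP. *)
Definition lie_prod U V : {vspace g} :=
  <<allpairs (@lie F g) (vbasis U) (vbasis V)>>%VS.

Lemma memv_lie_prod U V x y :
  x \in U -> y \in V -> lie x y \in lie_prod U V.
Proof.
move=> /coord_vbasis-> /coord_vbasis->.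
rewrite linear_sum memv_suml // => j _; rewrite linearZ memvZ //=.
rewrite lie_anti linear_sum memvN memv_suml // => i _.
rewrite linearZ memvZ //= lie_anti memvN.
by rewrite memv_span //; apply/allpairsP; exists ((vbasis U)`_i, (vbasis V)`_j);
   rewrite !memt_nth.
Qed.

Lemma lie_prodP U V W :
  reflect (forall x y, x \in U -> y \in V -> lie x y \in W)
          (lie_prod U V <= W)%VS.
Proof.
apply: (iffP idP) => [/subvP sUVW x y Ux Vy | sUVW].
  by apply: sUVW; apply: memv_lie_prod.
apply/span_subvP=> _ /allpairsP[[x y] /= [Ux Vy ->]].
by apply: sUVW; apply: vbasis_mem.
Qed.

Definition is_subalgebra s := (lie_prod s s <= s)%VS.
Definition is_ideal U := (lie_prod fullv U <= U)%VS.

Definition is_simple_lie : Prop :=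
  lie_prod fullv fullv != 0%VS /\
  forall U, is_ideal U -> U = 0%VS \/ U = fullv.

Definition lower_central h n : {vspace g} := iter n (lie_prod h) h.

Definition is_nilpotent h := exists n, lower_central h n = 0%VS.

Definition is_cartan h : Prop :=
  [/\ is_subalgebra h, is_nilpotent h &
      forall x, (forall y, y \in h -> lie x y \in h) -> x \in h].

Section Roots.

Variable h : {vspace g}.

(* The linear dual of h, with its vector space structure. *)
Definition dual := 'Hom(subvs_of h, F^o).

(* The common eigenspace of the elements of h; see rootspaceP. *)
Definition rootspace (a : dual) : {vspace g} :=
  (\bigcap_(x <- vbasis {:subvs_of h}) passmx.leigenspace (ad (vsval x)) (a x))%VS.

Lemma rootspaceP (a : dual) y :
  reflect (forall x : subvs_of h, lie (vsval x) y = (a x : F) *: y)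
          (y \in rootspace a).
Proof.
have eigP (x : subvs_of h) : (y \in passmx.leigenspace (ad (vsval x)) (a x)) =
    (lie (vsval x) y == (a x : F) *: y).
  by rewrite memv_ker !lfun_simp /= subr_eq0.
apply: (iffP idP) => [ya x | ya]; last first.
  rewrite /rootspace; elim/big_rec: _ => [|x U _ yU]; first exact: memvf.
  by rewrite memv_cap yU eigP ya eqxx.
have yb i : lie (vsval (vbasis {:subvs_of h})`_i) y =
            (a (vbasis {:subvs_of h})`_i : F) *: y.
  have [lti|lei] := ltnP i (size (vbasis {:subvs_of h})); last first.
    by rewrite nth_default // linear0 lie0l linear0 scale0r.
  apply/eqP; rewrite -eigP.
  move: ya; rewrite /rootspace (big_nth 0) big_mkord (bigD1 (Ordinal lti)) //=.
  by rewrite memv_cap => /andP[].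
rewrite (coord_vbasis (memvf x)) !linear_sum scaler_suml lie_anti linear_sum.
rewrite -sumrN; apply: eq_bigr => i _.
by rewrite !linearZ /= -lie_anti yb scalerA.
Qed.

Definition is_root (a : dual) := (a != 0) && (rootspace a != 0%VS).

(* There are only finitely many roots, so {fset dual} covers every set of
   roots. *)
Definition is_closed (T : {fset dual}) : Prop :=
  {subset T <= is_root} /\
  forall a b, a \in T -> b \in T -> is_root (a + b) -> a + b \in T.

Definition symm_part (T : {fset dual}) : {fset dual} :=
  [fset a in T | - a \in T]%fset.

Definition regular_subalg (T : {fset dual}) t : {vspace g} :=
  (t + \sum_(a <- T) rootspace a)%VS.

End Roots.

Record representation (V : vectType F) := Representation {
  rep_fun :> {linear g -> 'End(V)};
  rep_lie : forall x y, rep_fun (lie x y) =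
    (rep_fun x \o rep_fun y)%VF - (rep_fun y \o rep_fun x)%VF
}.

Lemma ad_lie x y : ad (lie x y) = (ad x \o ad y)%VF - (ad y \o ad x)%VF.
Proof.
apply/lfunP=> z; rewrite add_lfunE opp_lfunE !comp_lfunE !adE [LHS]lie_anti.
have /eqP := lie_jacobi x y z; rewrite addr_eq0 => /eqP <-.
by rewrite (lie_anti z x) linearN.
Qed.

Definition adjoint : representation g := @Representation g ad ad_lie.

Section Modules.

Variables (V : vectType F) (rho : representation V).

(* Only the action of the elements of s matters; for a subalgebra s these are
   the submodules of the restriction of V to s. *)
Definition is_submodule s (U : {vspace V}) : Prop :=
  forall x, x \in s -> (rho x @: U <= U)%VS.

Definition is_simple_module : Prop :=
  {:V}%VS != 0%VS /\
  forall U : {vspace V}, is_submodule fullv U -> U = 0%VS \/ U = fullv.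

(* V is not a direct sum of two nonzero s-submodules. *)
Definition is_indecomposable s : Prop :=
  ~ exists U W : {vspace V},
      [/\ is_submodule s U /\ is_submodule s W, U != 0%VS, W != 0%VS,
          (U + W)%VS = fullv & (U :&: W)%VS = 0%VS].

End Modules.

Definition is_wide s : Prop :=
  forall (V : vectType F) (rho : representation V),
    is_simple_module rho -> is_indecomposable rho s.

End LieAlgebras.

(* Main.v *)
Require Import Defs.
From HB Require Import structures.
From Stdlib Require Import Classical.
From mathcomp Require Import all_boot all_order all_algebra.
From mathcomp Require Import finmap complex reals.

(** Suppose that the adjoint module is indecomposable over [s] (the regular
    subalgebra) and let [V] be a simple module.  As [h] normalizes [s], the
    algebra [A] of [s]-endomorphisms of [V] is stable under commutators with
    [h], and since [h] acts diagonalizably on [V], [A] is graded by weights.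

    - The part of weight zero of [A] consists of scalars
      ([cartan_invariant_scalar]).  If [b] is in it, its centralizer [S] in [g]
      is a subalgebra containing [s] and [h].  When [e] is a root vector in [S]
      and [f] a root vector with [killing e f != 0], then [f] is in [S] too: in
      the module of endomorphisms of [V], [b] is killed by [e] and has weight
      zero for the sl2-triple that [e], [f] and their bracket form up to
      scaling, so that it is killed by [f] ([sl2_weight0]).  Hence the Killing form is
      nondegenerate on [S], and [g] is the direct sum of [S] and its
      orthogonal, both [s]-stable.  Therefore [S = g], and Schur's lemma
      applies.

    - If [a] and [b] in [A] have weights and that of [a] is not zero, then
      the trace of [a b] is zero ([weight_intertwiner_trace0]).  This is clear
      unless the weights are opposite.  In that case [a b] and [b a] are
      scalars, and equal since they have the same trace, so that choosing [y]
      in [h] with [[y, a] = c a] and [c != 0] gives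
      [c tr (a b) = tr ([y, a] b) = tr (y [a, b]) = 0].

    - So for each [a] in [A] there is [c] such that [tr (a b) = c tr b] for
      all [b] in [A] ([intertwiner_trace]).  For the projection [e] onto a
      summand, [b = 1] and [b = e] give [tr e = c dim V = c tr e], whence [tr e]
      is [0] or [dim V] and [e] is [0] or [1].

    The other implication holds because the adjoint module is simple.

    What this takes from the structure theory of [g] is that the Killing form
    is nondegenerate and that a nilpotent self-normalizing [h] is abelian and
    acts diagonalizably.  The recurring tool is a form of Cartan's criterion:
    if [X] has semisimple part with eigenvalues [c] and [X'] acts by the
    conjugate of [c] on the same generalized eigenspaces, the trace of [X X']
    is a sum of squared moduli, so that its vanishing makes [X] nilpotent
    ([conj_trace_nilpotent]).  This gives nondegeneracy, with Engel's theorem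
    ([cartan_engel]); then all derivations are inner, and the semisimple part
    of [ad y], being a derivation, is [ad] of an element of [h] when [y] is in
    [h] ([cartan_semisimple]). *)

Import GRing.Theory.
Local Open Scope ring_scope.

Set Implicit Arguments.
Unset Strict Implicit.
Unset Printing Implicit Defensive.
Import Order.TTheory Num.Theory VectorInternalTheory.

(** * Subspaces and linear maps *)

Lemma dimv_add_line (F : fieldType) (V : vectType F) (U : {vspace V}) v :
  v \notin U -> (\dim U < \dim (U + <[v]>))%N.
Proof.
move=> vU; rewrite ltn_neqAle dimvS ?addvSl // andbT; apply: contra vU => /eqP Ed.
have /eqP -> : U == (U + <[v]>)%VS by rewrite eqEdim addvSl Ed leqnn.
by apply: (subvP (addvSr _ _)); apply: memv_line.
Qed.

(** A subspace of largest dimension inside [P] is all of [P]. *)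
Lemma linear_pred_vspace (F : fieldType) (V : vectType F) (P : V -> Prop) :
    P 0 -> (forall a u v, P u -> P v -> P (a *: u + v)) ->
  exists W : {vspace V}, forall v, v \in W <-> P v.
Proof.
move=> P0 PD.
suff: forall n (W : {vspace V}), (\dim {:V} - \dim W <= n)%N ->
    (forall v, v \in W -> P v) -> exists W : {vspace V}, forall v, v \in W <-> P v.
  move/(_ _ 0%VS (leqnn _)); apply => v; rewrite memv0 => /eqP -> //.
elim=> [|n IHn] W leWn WP.
  exists W => v; split=> [/WP //|_]; suff -> : W = fullv by apply: memvf.
  by apply/eqP; rewrite eqEdim subvf -subn_eq0 -leqn0.
have [PW|nPW] := classic (forall v, P v -> v \in W).
  by exists W => v; split; [apply: WP | apply: PW].
have [v /(imply_to_and (P v)) [Pv /negP vW]] := not_all_ex_not _ _ nPW.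
apply: (IHn (W + <[v]>)%VS) => [|u]; last first.
  by case/memv_addP=> w wW [_ /vlineP [a ->] ->]; rewrite addrC; apply: PD; auto.
rewrite -ltnS; apply: leq_trans leWn; have ltW := dimv_add_line vW.
by apply: ltn_sub2l => //; apply: leq_trans ltW (dimvS (subvf _)).
Qed.

Section LfunMorphism.

Variables (F : fieldType) (V W : vectType F) (X : 'Hom(V, W)).
Implicit Types (v w : V).

Lemma lfun0 : X 0 = 0. Proof. exact: linear0. Qed.
Lemma lfunD v w : X (v + w) = X v + X w. Proof. exact: linearD. Qed.
Lemma lfunB v w : X (v - w) = X v - X w. Proof. exact: linearB. Qed.
Lemma lfunZ a v : X (a *: v) = a *: X v. Proof. exact: linearZ. Qed.

End LfunMorphism.

(** * Traces and eigenvalues *)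

Section Trace.

Variables (F : numClosedFieldType) (V : vectType F).
Implicit Types (X Y Z : 'End(V)) (v : V) (c : F).

Definition lftrace X : F := \tr (f2mx X).

Lemma v2r_lfun X v : v2r (X v) = v2r v *m f2mx X.
Proof. by rewrite unlock /= r2vK. Qed.

Lemma f2mx_comp X Y : f2mx (X \o Y)%VF = f2mx Y *m f2mx X.
Proof.
apply/row_matrixP => i; rewrite !rowE; set w := delta_mx 0 i.
by rewrite -[w]r2vK mulmxA -!v2r_lfun comp_lfunE.
Qed.

Fact lftrace_is_linear : linear_for *%R lftrace.
Proof.
move=> a X Y; rewrite /lftrace -linearP; congr (\tr _).
apply/row_matrixP => i; rewrite !rowE mulmxDr -scalemxAr.
by rewrite -[delta_mx 0 i]r2vK -!v2r_lfun add_lfunE scale_lfunE linearP.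
Qed.
HB.instance Definition _ :=
  GRing.isLinear.Build F 'End(V) F *%R lftrace lftrace_is_linear.

Lemma lftraceC X Y : lftrace (X \o Y)%VF = lftrace (Y \o X)%VF.
Proof. by rewrite /lftrace !f2mx_comp mxtrace_mulC. Qed.

Lemma lftrace1 : lftrace \1%VF = (\dim {:V})%:R.
Proof.
rewrite /lftrace; have -> : f2mx (\1%VF : 'End(V)) = 1%:M.
  apply/row_matrixP => i; rewrite !rowE mulmx1.
  by rewrite -[delta_mx 0 i]r2vK -v2r_lfun id_lfunE.
by rewrite mxtrace1 dimvf.
Qed.

(** The eigenvalues are the roots of the characteristic polynomial, whose
    second coefficient is minus the trace. *)
Lemma lftrace_eigenvalues X : exists cs : seq F,
  [/\ size cs = \dim {:V}, lftrace X = \sum_(c <- cs) c &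
      forall c, c \in cs <-> exists2 v, v != 0 & X v = c *: v].
Proof.
have [cs Ecs] := closed_field_poly_normal (char_poly (f2mx X)).
rewrite (monicP (char_poly_monic _)) scale1r in Ecs.
have szcs : size cs = dim V.
  by apply: succn_inj; rewrite -(size_char_poly (f2mx X)) Ecs size_prod_XsubC.
exists cs; split=> [||c]; first by rewrite dimvf.
  have [d0|dpos] := posnP (dim V).
    rewrite [cs]size0nil ?szcs // big_nil /lftrace /mxtrace.
    by rewrite big1 // => i; have := ltn_ord i; rewrite {2}d0.
  apply: oppr_inj; rewrite /lftrace -char_poly_trace // Ecs.
  by rewrite -szcs coefPn_prod_XsubC // szcs -lt0n.
have -> : (c \in cs) = eigenvalue (f2mx X) c.
  by rewrite eigenvalue_root_char Ecs root_prod_XsubC.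
split=> [/eigenvalueP [u uX u0] | [v v0 Xv]].
  exists (r2v u); first by rewrite -(inj_eq (can_inj v2rK)) r2vK linear0.
  by apply: (can_inj v2rK); rewrite v2r_lfun linearZ /= !r2vK.
apply/eigenvalueP; exists (v2r v); first by rewrite -v2r_lfun Xv linearZ.
by rewrite -(linear0 (@v2r F V)) (inj_eq (can_inj v2rK)).
Qed.

Lemma lftrace_eig0 X :
  (forall c v, v != 0 -> X v = c *: v -> c = 0) -> lftrace X = 0.
Proof.
move=> eig0; have [cs [_ -> csP]] := lftrace_eigenvalues X.
by rewrite big1_seq // => c /andP[_ /csP [v]]; apply: eig0.
Qed.

Lemma lftrace0_eig_ge0 X :
    (forall c v, v != 0 -> X v = c *: v -> 0 <= c) -> lftrace X = 0 ->
  forall c v, v != 0 -> X v = c *: v -> c = 0.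
Proof.
move=> eig_ge0; have [cs [_ -> csP]] := lftrace_eigenvalues X => /eqP.
rewrite big_seq_cond psumr_eq0 => [/allP cs0 c v v0 Xv|c]; last first.
  by rewrite andbT => /csP [v v0 Xv]; apply: eig_ge0 Xv.
have ccs : c \in cs by apply/csP; exists v.
by have := cs0 c ccs; rewrite ccs => /eqP.
Qed.

Lemma finite_spectrum X :
  exists cs : seq F, forall c v, v != 0 -> X v = c *: v -> c \in cs.
Proof.
have [cs [_ _ csP]] := lftrace_eigenvalues X.
by exists cs => c v v0 Xv; apply/csP; exists v.
Qed.

Lemma idempotent_trace0 (e : 'End(V)) :
  (forall v, e (e v) = e v) -> lftrace e = 0 -> forall v, e v = 0.
Proof.
move=> ee tr0 v; apply/eqP/negP => /negP ev0.
suff /eqP : 1 = 0 :> F by rewrite oner_eq0.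
apply: (lftrace0_eig_ge0 _ tr0 ev0); last by rewrite scale1r.
move=> c w w0 ew; have := ee w; rewrite ew lfunZ ew scalerA.
move/eqP; rewrite -subr_eq0 -scalerBl scaler_eq0 (negPf w0) orbF -[X in _ - X]mulr1.
rewrite -mulrBr mulf_eq0 => /orP [/eqP -> //|].
by rewrite subr_eq0 => /eqP ->; apply: ler01.
Qed.

Lemma trace_lie (X Y Z : 'End(V)) :
  lftrace (((X \o Y) - (Y \o X)) \o Z)%VF =
  lftrace (X \o ((Y \o Z) - (Z \o Y)))%VF.
Proof.
rewrite comp_lfunDl comp_lfunDr comp_lfunNl comp_lfunNr !linearB /=.
by rewrite -!comp_lfunA [lftrace (Y \o _)%VF]lftraceC -comp_lfunA.
Qed.

End Trace.

Section EigenvectorExists.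

Variables (F : numClosedFieldType) (V : vectType F).
Implicit Types (X Y Z : 'End(V)) (v : V) (c : F) (U : {vspace V}).

Definition stable_under X U := forall v, v \in U -> X v \in U.

Lemma eigenvector_exists X U : stable_under X U -> U != 0%VS ->
  exists c v, [/\ v \in U, v != 0 & X v = c *: v].
Proof.
move=> sXU U0.
pose f (u : subvs_of U) := vsproj U (X (vsval u)).
have flin : linear f by move=> a u w; rewrite /f !linearP.
pose fl : {linear subvs_of U -> subvs_of U} :=
  HB.pack f (GRing.isLinear.Build _ _ _ _ f flin).
have [[|c cs] [/= sz _ csP]] := lftrace_eigenvalues (linfun fl).
  have dimU : \dim {:subvs_of U} = \dim U := dimvf _.
  by move: U0; rewrite -dimv_eq0 -dimU -sz.
have [|u u0 uc] := (csP c).1; first exact: mem_head.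
exists c, (vsval u); split; first exact: subvsP.
  by apply: contra u0 => /eqP u0; apply/eqP/val_inj.
have := congr1 vsval uc; rewrite (lfunE fl u : linfun fl u = f u).
by rewrite /f vsprojK //; apply/sXU/subvsP.
Qed.

Lemma lker_dim_compl X U : (U :&: lker X :&: X @: U = 0)%VS ->
  stable_under X U -> (U <= (U :&: lker X) + X @: U)%VS.
Proof.
move=> disj sXU.
have sub : ((U :&: lker X) + X @: U <= U)%VS.
  rewrite subv_add capvSl; apply/subvP => _ /memv_imgP [u uU ->].
  exact: sXU.
have /eqP -> // : (U :&: lker X + X @: U == U)%VS.
by rewrite eqEdim sub -(limg_ker_dim X U) dimv_disjoint_sum /= ?leqnn.
Qed.

End EigenvectorExists.

(** * Generalized eigenvectors *)

Lemma bounded_max (f : nat -> nat) N : (forall k, f k <= N)%N ->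
  exists k, forall m, (f m <= f k)%N.
Proof.
move=> fN; suff: forall n k, (N - f k <= n)%N -> exists k, forall m, (f m <= f k)%N.
  by move/(_ N 0%N); apply; apply: leq_subr.
elim=> [|n IHn] k lekn.
  exists k => m; apply: leq_trans (fN m) _; by rewrite -subn_eq0 -leqn0.
have [[m ltkm]|nex] := classic (exists m, f k < f m)%N.
  apply: (IHn m); rewrite -ltnS (leq_trans _ lekn) // ltn_sub2l //.
  exact: leq_trans ltkm (fN m).
by exists k => m; rewrite leqNgt; apply/negP => ltkm; apply: nex; exists m.
Qed.

Section GeneralizedEigenvectors.

Variables (F : numClosedFieldType) (V : vectType F).
Implicit Types (X Y Z : 'End(V)) (v w : V) (c d : F) (U W : {vspace V}).

Definition shift X c : 'End(V) := X - c *: \1%VF.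

Lemma shiftE X c v : shift X c v = X v - c *: v.
Proof. by rewrite add_lfunE opp_lfunE scale_lfunE id_lfunE. Qed.

(** Leaving the exponent existential makes products of generalized eigenvectors
    easy to handle; [gvec_stable_exponent] provides a uniform one. *)
Definition gvec X c v := exists k, iter k (shift X c) v = 0.

Lemma iter_lfun0 k Y : iter k Y 0 = 0.
Proof. by elim: k => //= k ->; rewrite lfun0. Qed.

Lemma iter_lfunD k Y v w : iter k Y (v + w) = iter k Y v + iter k Y w.
Proof. by elim: k => //= k ->; rewrite lfunD. Qed.

Lemma iter_lfun_comm k Y (f : V -> V) v :
  (forall u, f (Y u) = Y (f u)) -> iter k Y (f v) = f (iter k Y v).
Proof. by move=> fY; elim: k => //= k ->; rewrite fY. Qed.

Lemma iter_lfun_le k m Y v :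
  (k <= m)%N -> iter k Y v = 0 -> iter m Y v = 0.
Proof. by move=> /subnK <- Yv; rewrite iterD Yv iter_lfun0. Qed.

Lemma shift_comm X c v : shift X c (X v) = X (shift X c v).
Proof. by rewrite !shiftE lfunB lfunZ. Qed.

Lemma gvec0 X c : gvec X c 0.
Proof. by exists 0%N. Qed.

Lemma eig_gvec X c v : X v = c *: v -> gvec X c v.
Proof. by move=> Xv; exists 1%N; rewrite /= shiftE Xv subrr. Qed.

Lemma gvec_comm X (Y : V -> V) c v :
    (forall u, Y (shift X c u) = shift X c (Y u)) ->
  Y 0 = 0 -> gvec X c v -> gvec X c (Y v).
Proof. by move=> cYX Y0 [k vk]; exists k; rewrite iter_lfun_comm // vk. Qed.

Lemma gvec_shift X c d v : gvec X c v -> gvec X c (shift X d v).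
Proof.
apply: gvec_comm; last exact: lfun0.
by move=> u; rewrite shiftE (shiftE X d u) lfunB lfunZ shift_comm.
Qed.

Lemma gvec_eigvec X c v : v != 0 -> gvec X c v ->
  exists j, iter j (shift X c) v != 0 /\
            X (iter j (shift X c) v) = c *: iter j (shift X c) v.
Proof.
move=> v0 [k]; elim: k => [|k IHk] /= vk; first by rewrite vk eqxx in v0.
have [/IHk //|ukn] := eqVneq (iter k (shift X c) v) 0.
by exists k; split=> //; apply/eqP; rewrite -subr_eq0 -shiftE vk.
Qed.

Lemma gvec_iter_shift X c d k v :
  gvec X c v -> gvec X c (iter k (shift X d) v).
Proof. by move=> vc; elim: k => //= k; apply: gvec_shift. Qed.

Lemma gvec_uniq X c d v : c != d -> gvec X c v -> gvec X d v -> v = 0.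
Proof.
move=> ncd vc vd; apply/eqP/negP => /negP v0.
have [j [u0 Xu]] := gvec_eigvec v0 vc.
move: (iter j _ v) u0 Xu (gvec_iter_shift c j vd) => u u0 Xu [m um].
have Eu : shift X d u = (c - d) *: u by rewrite shiftE Xu scalerBl.
have : iter m (shift X d) u = (c - d) ^+ m *: u.
  elim: m {um} => [|m IHm] /=; first by rewrite expr0 scale1r.
  by rewrite IHm lfunZ Eu scalerA -exprSr.
by move/eqP; rewrite um eq_sym scaler_eq0 expf_eq0 subr_eq0 (negPf ncd)
                      (negPf u0) andbF.
Qed.

Definition lpow k Y : 'End(V) := iter k (comp_lfun Y) \1%VF.

Lemma lpowE k Y v : lpow k Y v = iter k Y v.
Proof. by elim: k => [|k IHk] /=; rewrite ?id_lfunE ?comp_lfunE ?IHk. Qed.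

Lemma gvec_stable_exponent X c :
  exists k, forall v, gvec X c v <-> lpow k (shift X c) v = 0.
Proof.
set K := fun k => lker (lpow k (shift X c)).
have Kle k m : (k <= m)%N -> (K k <= K m)%VS.
  move=> lekm; apply/subvP => v; rewrite !memv_ker !lpowE => /eqP vk.
  by rewrite (iter_lfun_le lekm vk).
have [k kmax] := bounded_max (fun k => dimvS (subvf (K k))).
exists k => v; split=> [[m vm]|]; last by rewrite lpowE; exists k.
have [lekm|/ltnW lemk] := leqP k m; last by rewrite lpowE (iter_lfun_le lemk vm).
have /eqP Ekm : K k == K m by rewrite eqEdim Kle ?kmax.
by apply/eqP; rewrite -memv_ker -/(K k) Ekm memv_ker lpowE vm.
Qed.

Lemma shift_stable X c U : stable_under X U -> stable_under (shift X c) U.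
Proof. by move=> sXU v vU; rewrite shiftE memvB ?memvZ ?sXU. Qed.

Lemma lpow_stable k Y U : stable_under Y U -> stable_under (lpow k Y) U.
Proof. by move=> sYU v vU; rewrite lpowE; elim: k => //= k; apply: sYU. Qed.

(** Fitting's decomposition: with [k] an exponent such that the kernel of
    [(X - c)^k] has stopped growing, kernel and image of this power are
    complementary. *)
Lemma fitting X c U : stable_under X U -> exists K I : {vspace V},
  [/\ forall v, v \in K <-> v \in U /\ gvec X c v,
      (U <= K + I)%VS, (K :&: I = 0)%VS, (I <= U)%VS &
      stable_under X I].
Proof.
move=> sXU; have [k kP] := gvec_stable_exponent X c.
set Y := lpow k (shift X c).
have sYU : stable_under Y U by apply/lpow_stable/shift_stable.
have disj : (U :&: lker Y :&: Y @: U = 0)%VS.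
  apply/eqP; rewrite -subv0; apply/subvP => w.
  rewrite !memv_cap memv_ker => /andP[/andP[_ /eqP Yw] /memv_imgP [u uU Ew]].
  rewrite memv0 Ew; apply/eqP/kP; exists (k + k)%N.
  by rewrite iterD -!lpowE -/Y -Ew.
exists (U :&: lker Y)%VS, (Y @: U)%VS; split=> //.
- move=> v; rewrite memv_cap memv_ker kP.
  by split=> [/andP[-> /eqP]|[-> /eqP]].
- exact: lker_dim_compl.
- by apply/subvP => _ /memv_imgP [u uU ->]; apply: sYU.
move=> _ /memv_imgP [u uU ->].
suff -> : X (Y u) = Y (X u) by apply/memv_img/sXU.
by rewrite !lpowE (@iter_lfun_comm _ _ X) // => w; rewrite shift_comm.
Qed.

(** The form of Fitting's decomposition that supports induction on the
    dimension: for an eigenvalue [c] the image is smaller. *)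
Lemma fitting_eigenvalue X U : stable_under X U -> U != 0%VS ->
  exists c, exists K I : {vspace V},
    [/\ forall v, v \in K <-> v \in U /\ gvec X c v,
        (U <= K + I)%VS, (K :&: I = 0)%VS, (I <= U)%VS &
        stable_under X I] /\ (\dim I < \dim U)%N.
Proof.
move=> sXU U0; have [c [v [vU v0 Xv]]] := eigenvector_exists sXU U0.
have [K [I KI]] := fitting c sXU; exists c, K, I; split=> //.
have [KP _ disj IU _] := KI.
have vK : v \in K by apply/KP; split=> //; apply: eig_gvec.
rewrite ltn_neqAle dimvS // andbT; apply: contra v0 => /eqP dimI.
have /eqP EI : I == U by rewrite eqEdim IU dimI leqnn.
by rewrite -memv0 -disj memv_cap vK EI.
Qed.

(** Over a closed field, a stable subspace is spanned by the generalized
    eigenvectors that it contains. *)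
Lemma gvec_span X U W : stable_under X U ->
  (forall c v, v \in U -> gvec X c v -> v \in W) -> (U <= W)%VS.
Proof.
have [n] := ubnP (\dim U); elim: n U => // n IHn U ltUn sXU gW.
have [->|U0] := eqVneq U 0%VS; first exact: sub0v.
have [c [K [I [[KP UKI _ IU sXI] ltIU]]]] := fitting_eigenvalue sXU U0.
apply: (subv_trans UKI); rewrite subv_add; apply/andP; split.
  by apply/subvP => u /KP [uU uc]; apply: gW uc.
apply: IHn => // [|d u /(subvP IU)]; last exact: gW.
by rewrite -ltnS; apply: leq_trans ltUn.
Qed.

(** For [phi] the identity, [S] is the semisimple part of [X]; the conjugation
    is the other useful choice.  Induction on the dimension of a stable
    subspace, gluing along Fitting's decomposition. *)
Lemma semisimple_part (phi : F -> F) X :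
  exists S : 'End(V), forall c v, gvec X c v -> S v = phi c *: v.
Proof.
suff [S SP] : exists S : 'End(V), forall c v, v \in fullv -> gvec X c v ->
    S v = phi c *: v by exists S => c v; apply: SP; apply: memvf.
have: stable_under X fullv by move=> v _; apply: memvf.
move: fullv => U; have [n] := ubnP (\dim U); elim: n U => // n IHn U ltUn sXU.
have [->|U0] := eqVneq U 0%VS.
  by exists 0 => c v; rewrite memv0 => /eqP -> _; rewrite lfun0 scaler0.
have [c [K [I [[KP UKI disj IU sXI] ltIU]]]] := fitting_eigenvalue sXU U0.
have [|//|S SP] := IHn I; first by rewrite -ltnS; apply: leq_trans ltUn.
exists (phi c *: daddv_pi K I + (S \o daddv_pi I K)%VF) => d u uU.
rewrite add_lfunE scale_lfunE comp_lfunE.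
have /memv_addP [k kK [i iI ->]] := subvP UKI u uU.
have disj' : (I :&: K = 0)%VS by rewrite capvC.
have piKi : daddv_pi K I i = 0.
  apply: (addIr (daddv_pi I K i)); rewrite add0r daddv_pi_add //.
    by rewrite daddv_pi_id.
  by apply: (subvP (addvSr K I)).
have piIk : daddv_pi I K k = 0.
  apply: (addIr (daddv_pi K I k)); rewrite add0r daddv_pi_add //.
    by rewrite daddv_pi_id.
  by apply: (subvP (addvSr I K)).
rewrite !lfunD piKi piIk !daddv_pi_id // lfun0 addr0 add0r => -[m].
rewrite iter_lfunD => Ekim.
have [kU [p kp]] := (KP k).1 kK.
have sK : iter m (shift X d) k \in K.
  apply/KP; split; last by apply: gvec_iter_shift; exists p.
  by rewrite -lpowE; apply/lpow_stable/kU/shift_stable.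
have km : iter m (shift X d) k = 0.
  apply/eqP; rewrite -memv0 -disj memv_cap sK -[iter _ _ _]opprK.
  rewrite memvN (addr0_eq Ekim) -lpowE.
  by apply/lpow_stable/iI/shift_stable.
have im : iter m (shift X d) i = 0 by rewrite -[RHS]Ekim km add0r.
have [Ecd|ncd] := eqVneq c d; last first.
  rewrite (gvec_uniq ncd _ (ex_intro _ m km)); last by exists p.
  by rewrite scaler0 !add0r (SP d) //; exists m.
have -> : i = 0.
  apply/eqP; rewrite -memv0 -disj memv_cap iI andbT; apply/KP.
  by split; [apply: (subvP IU) | exists m; rewrite Ecd].
by rewrite lfun0 !addr0 Ecd.
Qed.

End GeneralizedEigenvectors.

(** * Nilpotent and semisimple parts *)

Section SpectralTools.

Variables (F : numClosedFieldType) (V : vectType F).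
Implicit Types (X Y S : 'End(V)) (v w : V) (c d : F) (U W : {vspace V}).

Lemma gvec_lfunP (V' : vectType F) X (f g : 'Hom(V, V')) :
  (forall c v, gvec X c v -> f v = g v) -> f = g.
Proof.
move=> fg; apply/lfunP => v; apply/eqlfunP.
have sX : stable_under X fullv by move=> u _; apply: memvf.
apply: (subvP (gvec_span sX (W := lker (f - g)) _)); last exact: memvf.
by move=> c u _ uc; apply/eqlfunP/fg/uc.
Qed.

Definition nilpotent_lfun X := forall v, gvec X 0 v.

Lemma nilpotent_span X :
    (forall W, (forall v, gvec X 0 v -> v \in W) -> (fullv <= W)%VS) ->
  nilpotent_lfun X.
Proof.
have [k kP] := gvec_stable_exponent X 0 => spanX v.
apply/kP/eqP; rewrite -memv_ker; apply: (subvP (spanX _ _)); last exact: memvf.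
by move=> u /kP /eqP; rewrite memv_ker.
Qed.

Lemma nilpotent_gvec X :
  (forall c v, gvec X c v -> gvec X 0 v) -> nilpotent_lfun X.
Proof.
move=> X0; apply: nilpotent_span => W gW.
by apply: (@gvec_span _ _ X) => [v _|c v _ /X0 /gW //]; apply: memvf.
Qed.

Lemma nilpotent_eig0 X :
  (forall c v, v != 0 -> X v = c *: v -> c = 0) -> nilpotent_lfun X.
Proof.
move=> eig0; apply: nilpotent_gvec => c v vc.
have [->|v0] := eqVneq v 0; first exact: gvec0.
by have [j [u0 /(eig0 _ _ u0) c0]] := gvec_eigvec v0 vc; rewrite -c0.
Qed.

Lemma nilpotent_eig X c v :
  nilpotent_lfun X -> v != 0 -> X v = c *: v -> c = 0.
Proof.
move=> nX v0 Xv; apply/eqP; apply: contraNT v0 => c0.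
by apply/eqP; apply: (gvec_uniq c0 (eig_gvec Xv)).
Qed.

Lemma nilpotent_trace X : nilpotent_lfun X -> lftrace X = 0.
Proof. by move=> nX; apply: lftrace_eig0 => c v v0; apply: nilpotent_eig. Qed.

Lemma shift0 X v : shift X 0 v = X v.
Proof. by rewrite shiftE scale0r subr0. Qed.

Lemma iter_shift0 k X v : iter k (shift X 0) v = iter k X v.
Proof. by apply: eq_iter => u; apply: shift0. Qed.

Lemma nilpotent_comm X Y : nilpotent_lfun X ->
  (forall v, X (Y v) = Y (X v)) -> nilpotent_lfun (X \o Y)%VF.
Proof.
move=> nX cXY v; have [k vk] := nX v; exists k; move: vk; rewrite !iter_shift0.
move=> vk; suff -> : iter k (X \o Y)%VF v = iter k Y (iter k X v).
  by rewrite vk iter_lfun0.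
elim: k {vk} => //= k ->; rewrite comp_lfunE.
by rewrite -(@iter_lfun_comm _ _ k.+1 Y X).
Qed.

Lemma gvec_image X c v : c != 0 -> gvec X c v -> exists u, v = X u.
Proof.
move=> c0 [k]; elim: k v => [|k IHk] v; first by exists 0; rewrite lfun0.
rewrite iterSr => /IHk [u]; rewrite shiftE => Eu.
exists (c^-1 *: (v - u)); rewrite lfunZ lfunB -Eu opprB addrC subrK.
by rewrite scalerA mulVf ?scale1r.
Qed.

(** Uniqueness of the spectrum: if [c] were not in [D], the projection onto the
    generalized eigenspace of [c] would vanish on a spanning set. *)
Lemma gvec_spectrum (D : F -> Prop) X c v :
    (forall W, (forall d u, D d -> gvec X d u -> u \in W) -> (fullv <= W)%VS) ->
  gvec X c v -> v != 0 -> D c.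
Proof.
move=> spanD vc v0; apply: NNPP => nDc.
have [S SP] := semisimple_part (fun d => (d == c)%:R) X.
case/negP: v0; have /subvP/(_ v (memvf _)) : (fullv <= lker S)%VS.
  apply: spanD => d u Dd ud; rewrite memv_ker (SP _ _ ud).
  by have [Edc|_] := eqVneq d c; [case: nDc; rewrite -Edc | rewrite scale0r].
by rewrite memv_ker (SP _ _ vc) eqxx scale1r.
Qed.

Lemma semisimple_comm X S phi Y :
    (forall c v, gvec X c v -> S v = phi c *: v) ->
    (forall c v, gvec X c v -> gvec X c (Y v)) ->
  (S \o Y)%VF = (Y \o S)%VF.
Proof.
move=> SP YP; apply: (gvec_lfunP (X := X)) => c v vc.
by rewrite !comp_lfunE (SP _ _ vc) lfunZ (SP _ _ (YP _ _ vc)).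
Qed.

Lemma nilpotent_part X S :
  (forall c v, gvec X c v -> S v = c *: v) -> nilpotent_lfun (X - S).
Proof.
move=> SP; apply: nilpotent_span => W gW.
apply: (@gvec_span _ _ X) => [v _|c v _ vc]; first exact: memvf.
apply: gW; have [k vk] := vc; exists k; rewrite iter_shift0 -[RHS]vk.
elim: k {vk} => //= k ->; set u := iter _ _ _.
rewrite add_lfunE opp_lfunE (SP c) ?shiftE //; exact: gvec_iter_shift.
Qed.

(** On the generalized eigenspace of [X] for [c], the product [X S] has the only
    eigenvalue [c c^*], a nonnegative number.  So the vanishing of its trace
    forces all [c] to be zero. *)
Lemma conj_trace_nilpotent X S :
    (forall c v, gvec X c v -> S v = c^* *: v) ->
  lftrace (X \o S)%VF = 0 -> nilpotent_lfun X.
Proof.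
move=> SP tr0; set Y := (X \o S)%VF.
have YE u : Y u = X (S u) by rewrite comp_lfunE.
have gY c v : gvec X c v -> gvec Y (`|c| ^+ 2) v.
  move=> vc; have [k vk] := vc; exists k.
  suff -> : iter k (shift Y (`|c| ^+ 2)) v = (c^*) ^+ k *: iter k (shift X c) v.
    by rewrite vk scaler0.
  elim: k {vk} => [|k IHk] /=; first by rewrite expr0 scale1r.
  have := gvec_iter_shift c k vc; rewrite IHk lfunZ.
  move: (iter k _ v) => u uc; rewrite (shiftE Y) YE (SP _ _ uc) lfunZ.
  by rewrite normCKC -scalerA -scalerBr -shiftE scalerA -exprSr.
apply: nilpotent_eig0 => a v v0 Xv.
have Ya : Y v = (`|a| ^+ 2) *: v.
  by rewrite YE (SP a) ?lfunZ ?Xv ?scalerA ?normCKC //; apply: eig_gvec.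
have /eqP : `|a| ^+ 2 = 0.
  (* The squared moduli are the only eigenvalues of Y, so these are nonnegative. *)
  apply: lftrace0_eig_ge0 tr0 _ _ v0 Ya => c w w0 Yw.
  apply: (@gvec_spectrum (fun c => 0 <= c) Y c w) w0; last exact: eig_gvec.
  move=> W gW; apply: (@gvec_span _ _ X) => [u _|d u _ /gY]; first exact: memvf.
  by apply: gW; rewrite exprn_ge0.
by rewrite expf_eq0 normr_eq0 => /andP[_ /eqP].
Qed.

(** Joint version of [gvec_span], for operators preserving each other's
    generalized eigenspaces, as those of a nilpotent Lie algebra do: as long as
    some operator has two eigenvalues on [U], its generalized eigenspaces cut
    [U] into smaller stable pieces. *)
Lemma joint_gvec_span (O : 'End(V) -> Prop) U W :
    (forall X Y c v, O X -> O Y -> gvec X c v -> gvec X c (Y v)) ->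
    (forall X, O X -> stable_under X U) ->
    (forall v, v \in U -> (forall X, O X -> exists c, gvec X c v) -> v \in W) ->
  (U <= W)%VS.
Proof.
move=> cO; have [n] := ubnP (\dim U); elim: n U => // n IHn U ltUn sOU gW.
have [oneO|] :=
    classic (forall X, O X -> exists c, forall v, v \in U -> gvec X c v).
  apply/subvP => v vU; apply: gW => // X OX.
  by have [c cP] := oneO X OX; exists c; apply: cP.
move/not_all_ex_not=> [X] /(imply_to_and (O X)) [OX nX].
apply: (gvec_span (sOU X OX)) => c v vU vc.
have [K [_ [KP _ _ _ _]]] := fitting c (sOU X OX).
have KU : (K <= U)%VS by apply/subvP => u /KP [].
suff KW : (K <= W)%VS by apply: (subvP KW); apply/KP.
apply: IHn => [|Y OY u /KP [uU uc]|u /(subvP KU)]; last exact: gW.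
  rewrite -ltnS; apply: leq_trans ltUn; rewrite ltnS.
  rewrite ltn_neqAle dimvS // andbT; apply/negP => /eqP dimK; apply: nX.
  exists c => u uU; have /eqP EK : K == U by rewrite eqEdim KU dimK leqnn.
  by move: uU; rewrite -EK => /KP [].
by apply/KP; split; [apply: sOU | apply: cO uc].
Qed.

(** A bilinear form that is nondegenerate on [U] identifies [U] with its dual.
    In coordinates, [z] goes to the vector [phi z] whose coordinates are the
    values of [B z] on a basis of [U]; this endomorphism of [U] is injective. *)
Lemma functional_represented (B : V -> V -> F) U (f : V -> F) :
    (forall w, linear_for *%R (B^~ w)) -> (forall v, linear_for *%R (B v)) ->
    (forall z, z \in U -> (forall y, y \in U -> B z y = 0) -> z = 0) ->
    linear_for *%R f ->
  exists2 z, z \in U & forall y, y \in U -> B z y = f y.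
Proof.
move=> Bl Br ndB flin; pose b := vbasis U.
have lin0 (h : V -> F) : linear_for *%R h -> h 0 = 0.
  by move=> hlin; have := hlin (-1) 0 0; rewrite scaler0 addr0 mulN1r addNr.
have onbasis (h : V -> F) y : linear_for *%R h -> y \in U ->
    h y = \sum_(i < \dim U) coord b i y * h b`_i.
  move=> hlin /coord_vbasis {1}->; rewrite -/b.
  elim/big_rec2: _ => [|i v w _ <-]; [exact: lin0 | by rewrite hlin].
pose phi z : V := \sum_(i < \dim U) B z b`_i *: b`_i.
have phil : linear phi.
  move=> a u w; rewrite /phi scaler_sumr -big_split; apply: eq_bigr => i _.
  by rewrite /= Bl scalerDl scalerA.
pose Phi : {linear V -> V} := HB.pack phi (GRing.isLinear.Build _ _ _ _ phi phil).
have PhiE z : linfun Phi z = phi z := lfunE Phi z.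
have bU i : (i < \dim U)%N -> b`_i \in U.
  by move=> lti; apply/vbasis_mem/mem_nth; rewrite size_tuple.
have sumU (h : 'I_(\dim U) -> F) : \sum_(i < \dim U) h i *: b`_i \in U.
  by apply: memv_suml => i _; apply/memvZ/bU.
have coefs (h k : 'I_(\dim U) -> F) :
    \sum_(i < \dim U) h i *: b`_i = \sum_(i < \dim U) k i *: b`_i -> h =1 k.
  move=> Ehk i; have /freeP fb := basis_free (vbasisP U).
  apply/eqP; rewrite -subr_eq0; apply/eqP; move: i; apply: fb.
  rewrite -[RHS](subrr (\sum_i h i *: b`_i)) {2}Ehk -sumrB.
  by apply: eq_bigr => i _; rewrite scalerBl.
have capU : (U :&: lker (linfun Phi) = 0)%VS.
  apply/eqP; rewrite -subv0; apply/subvP => z; rewrite memv_cap memv_ker PhiE.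
  case/andP=> zU /eqP phi0; rewrite memv0; apply/eqP/ndB => // y yU.
  have Bz0 : (fun i : 'I_(\dim U) => B z b`_i) =1 (fun=> 0).
    by apply: coefs; rewrite -/(phi z) phi0 big1 // => i _; rewrite scale0r.
  rewrite (onbasis (B z)) // big1 // => i _.
  by have /= -> := Bz0 i; rewrite mulr0.
have Eim : (linfun Phi @: U = U)%VS.
  apply/eqP; rewrite eqEdim limg_dim_eq // leqnn andbT.
  by apply/subvP => _ /memv_imgP [z zU ->]; rewrite PhiE; apply: sumU.
have : \sum_(i < \dim U) f b`_i *: b`_i \in (linfun Phi @: U)%VS.
  by rewrite Eim; apply: sumU.
move=> /memv_imgP [z zU]; rewrite PhiE => /coefs fB.
exists z => // y yU; rewrite (onbasis (B z)) // (onbasis f) //.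
by apply: eq_bigr => i _; rewrite fB.
Qed.

End SpectralTools.

(** * Representations and the Killing form *)

Section Representations.

Variables (F : numClosedFieldType) (g : lieAlgType F).
Implicit Types (x y z : g).

Section OneRepresentation.

Variables (V : vectType F) (rho : representation g V).

Lemma rep_lieE x y v : rho (lie x y) v = rho x (rho y v) - rho y (rho x v).
Proof. by rewrite rep_lie add_lfunE opp_lfunE !comp_lfunE. Qed.

Lemma repD x y v : rho (x + y) v = rho x v + rho y v.
Proof. by rewrite linearD add_lfunE. Qed.

Lemma repZ a x v : rho (a *: x) v = a *: rho x v.
Proof. by rewrite linearZ scale_lfunE. Qed.

Lemma repB x y v : rho (x - y) v = rho x v - rho y v.
Proof. by rewrite linearB add_lfunE opp_lfunE. Qed.

Lemma rep0 v : rho 0 v = 0.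
Proof. by rewrite linear0 zero_lfunE. Qed.

Lemma rep_commute x y v : rho x (rho y v) = rho y (rho x v) + rho (lie x y) v.
Proof. by rewrite rep_lieE addrC subrK. Qed.

(** The binomial formula behind weights adding up, by Leibniz:
    [y - (a + b)] applied to [x v] is [((y - a) x) v + x ((y - b) v)]. *)
Lemma gvec_rep y a b x v : gvec (ad y) a x -> gvec (rho y) b v ->
  gvec (rho y) (a + b) (rho x v).
Proof.
move=> [k xk] [m vm]; exists (k + m)%N; move: {2 3}(k + m)%N (leqnn (k + m)) => n.
elim: n k m x v xk vm => [|n IHn] k m x v xk vm.
  by rewrite leqn0 addn_eq0 => /andP[/eqP k0 _]; move: xk; rewrite k0 /= => ->;
     rewrite rep0.
move=> lekmn; rewrite iterSr.
have -> : shift (rho y) (a + b) (rho x v) =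
    rho (shift (ad y) a x) v + rho x (shift (rho y) b v).
  rewrite !shiftE adE rep_commute repB repZ lfunB lfunZ scalerDl opprD !addrA.
  by congr (_ - _); rewrite [RHS]addrC addrA.
rewrite iter_lfunD.
have -> : iter n (shift (rho y) (a + b)) (rho (shift (ad y) a x) v) = 0.
  case: k xk lekmn => [/= -> _|k xk lekmn]; last first.
    by apply: (IHn k m); rewrite -?iterSr.
  by rewrite lfun0 rep0 iter_lfun0.
rewrite add0r; case: m vm lekmn => [/= -> _|m vm lekmn]; last first.
  by apply: (IHn k m); rewrite -?iterSr // -ltnS -addnS.
by rewrite !lfun0 iter_lfun0.
Qed.

(** A primitive vector of weight zero is killed by [f].  The vectors
    [f^k v] have distinct weights, so one of them is zero; and [e] maps
    [f^(k+1) v] to a multiple of [f^k v] that is nonzero for [k > 0]. *)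
Lemma sl2_weight0 e f c v : c != 0 -> lie (lie e f) f = - c *: f ->
    rho e v = 0 -> rho (lie e f) v = 0 -> rho f v = 0.
Proof.
move=> c0 Hf ev Hv; pose w k := iter k (rho f) v.
have wS k : w k.+1 = rho f (w k) by [].
have Hw k : rho (lie e f) (w k) = (- c *+ k) *: w k.
  elim: k => [|k IHk]; first by rewrite mulr0n scale0r.
  rewrite wS rep_commute IHk Hf lfunZ repZ -scalerDl.
  by rewrite mulrS addrC.
(* The coefficient is the sum of the weights of w 0, ..., w k. *)
have ew k : rho e (w k.+1) = (- c *+ 'C(k.+1, 2)) *: w k.
  elim: k => [|k IHk]; first by rewrite wS rep_commute ev lfun0 add0r Hv scale0r.
  rewrite [w k.+2]wS rep_commute IHk Hw lfunZ -wS -scalerDl -mulrnDr.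
  by rewrite [in RHS]binS bin1.
have [k wk] : exists k, w k = 0.
  have [cs csP] := finite_spectrum (rho (lie e f)).
  apply: NNPP => nw.
  have w0 k : w k != 0 by apply/negP => /eqP wk; apply: nw; exists k.
  have sub : {subset [seq - c *+ k | k <- iota 0 (size cs).+1] <= cs}.
    by move=> _ /mapP [k _ ->]; apply: (csP _ _ (w0 k) (Hw k)).
  suff /uniq_leq_size/(_ sub) : uniq [seq - c *+ k | k <- iota 0 (size cs).+1].
    by rewrite size_map size_iota ltnn.
  rewrite map_inj_uniq ?iota_uniq // => i j /eqP.
  by rewrite !mulNrn eqr_opp -subr_eq0 -mulr_natl -[c *+ j]mulr_natl -mulrBl
       mulf_eq0 (negPf c0) orbF subr_eq0 eqr_nat => /eqP.
elim: k wk => [|[|k] IHk] wk //.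
  by have v0 : v = 0 := wk; rewrite v0 lfun0.
apply: IHk; have := ew k.+1; rewrite wk lfun0 => /esym/eqP.
rewrite scaler_eq0 => /orP [|/eqP //].
by rewrite mulNrn oppr_eq0 mulrn_eq0 (negPf c0) orbF => /eqP/eqP; 
  rewrite -leqn0 leqNgt bin_gt0.
Qed.

End OneRepresentation.

Definition killing x y : F := lftrace (ad x \o ad y)%VF.

Lemma killingC x y : killing x y = killing y x.
Proof. exact: lftraceC. Qed.

Lemma killing_linearl y : linear_for *%R (killing^~ y).
Proof.
by move=> a x z; rewrite /killing linearP comp_lfunDl -comp_lfunZl linearP.
Qed.

Lemma killing_linearr x : linear_for *%R (killing x).
Proof. by move=> a y z; rewrite !(killingC x) killing_linearl. Qed.

Lemma killing0l y : killing 0 y = 0.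
Proof. by rewrite /killing linear0 comp_lfun0l linear0. Qed.

Lemma killing0r x : killing x 0 = 0.
Proof. by rewrite killingC killing0l. Qed.

Lemma killingZl a x y : killing (a *: x) y = a * killing x y.
Proof. by rewrite -[a *: x]addr0 killing_linearl killing0l addr0. Qed.

Lemma killingZr a x y : killing x (a *: y) = a * killing x y.
Proof. by rewrite !(killingC x) killingZl. Qed.

Lemma killingNl x y : killing (- x) y = - killing x y.
Proof. by rewrite -scaleN1r killingZl mulN1r. Qed.

Lemma killingBl x y z : killing (x - y) z = killing x z - killing y z.
Proof. by rewrite addrC -scaleN1r killing_linearl mulN1r addrC. Qed.

Lemma killing_lie x y z : killing (lie x y) z = killing x (lie y z).
Proof. by rewrite /killing !ad_lie trace_lie. Qed.

End Representations.

(** * Cartan subalgebras of a simple Lie algebra *)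

Section SimpleLie.

Variables (F : numClosedFieldType) (g : lieAlgType F).
Implicit Types (x y z : g) (U W : {vspace g}).
Hypothesis simple_g : is_simple_lie g.

Lemma lieBl x y z : lie (x - y) z = lie x z - lie y z.
Proof. by rewrite -scaleN1r lieDl lieZl scaleN1r. Qed.

Lemma lieBr x y z : lie x (y - z) = lie x y - lie x z.
Proof. exact: linearB. Qed.

Lemma lie_full : lie_prod fullv fullv = fullv :> {vspace g}.
Proof.
have [nz /(_ (lie_prod fullv fullv))[]//] := simple_g; last first.
  by move=> E0; rewrite E0 eqxx in nz.
by apply/lie_prodP => x y _ _; apply: memv_lie_prod; apply: memvf.
Qed.

Lemma simple_lie_ideal (P : g -> Prop) :
    P 0 -> (forall a x y, P x -> P y -> P (a *: x + y)) ->
    (forall x y, P y -> P (lie x y)) ->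
  (forall x, P x -> x = 0) \/ (forall x, P x).
Proof.
move=> P0 PD PL; have [W WP] := linear_pred_vspace P0 PD.
have [|W0|Wf] := simple_g.2 W.
- by apply/lie_prodP => x y _ /WP /(PL x) /WP.
- by left=> x /WP; rewrite W0 memv0 => /eqP.
by right=> x; apply/WP; rewrite Wf memvf.
Qed.

Lemma lie_span (P : g -> Prop) :
    P 0 -> (forall a x y, P x -> P y -> P (a *: x + y)) ->
    (forall x y, P (lie x y)) ->
  forall x, P x.
Proof.
move=> P0 PD PL x; have [W WP] := linear_pred_vspace P0 PD.
have /subvP sW : (lie_prod fullv fullv <= W)%VS.
  by apply/lie_prodP => u v _ _; apply/WP.
by apply/WP/sW; rewrite lie_full memvf.
Qed.


(** Additivity of [phi] matches the additivity of weights under the bracket. *)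
Lemma semisimple_derivation x (S : 'End(g)) (phi : F -> F) :
    (forall a b, phi (a + b) = phi a + phi b) ->
    (forall c v, gvec (ad x) c v -> S v = phi c *: v) ->
  forall u v, S (lie u v) = lie (S u) v + lie u (S v).
Proof.
move=> phiD SP u v.
have sx : stable_under (ad x) fullv by move=> w _; apply: memvf.
have [|a w w' Ew Ew' v'|W WP] := @linear_pred_vspace _ _
    (fun u => forall v, S (lie u v) = lie (S u) v + lie u (S v)).
- by move=> w; rewrite !(lie0l, lfun0, addr0).
- rewrite lieDl lieZl !lfunD !lfunZ lieDl lieZl Ew Ew' lieDl lieZl scalerDr.
  by rewrite addrACA.
suff /subvP/(_ u (memvf _))/WP : (fullv <= W)%VS by [].
apply: (gvec_span sx) => a w _ wa; apply/WP => {}v.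
have [|b v1 v2 Ev1 Ev2|W' W'P] := @linear_pred_vspace _ _
    (fun v => S (lie w v) = lie (S w) v + lie w (S v)).
- by rewrite !(linear0, lfun0, addr0).
- rewrite !(lieDr, lieZr, lfunD, lfunZ) Ev1 Ev2 scalerDr.
  by rewrite addrACA.
suff /subvP/(_ v (memvf _))/W'P : (fullv <= W')%VS by [].
apply: (gvec_span sx) => b {}v _ vb; apply/W'P.
have := gvec_rep (rho := adjoint g) wa vb; rewrite /= !adE => /SP ->.
by rewrite (SP _ _ wa) (SP _ _ vb) lieZl lieZr -scalerDl phiD.
Qed.

Section Cartan.

Variable h : {vspace g}.
Hypothesis cartan_h : is_cartan h.

Lemma cartan_lie x y : x \in h -> y \in h -> lie x y \in h.
Proof. by move=> xh yh; have [/lie_prodP hh _ _] := cartan_h; apply: hh. Qed.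

Lemma lower_central_sub n : (lower_central h n <= h)%VS.
Proof.
elim: n => [|n IHn] //=; apply/lie_prodP => x y xh yh.
by apply: cartan_lie => //; apply: (subvP IHn).
Qed.

Lemma cartan_ad_nilpotent y w : y \in h -> w \in h -> gvec (ad y) 0 w.
Proof.
move=> yh wh; have [_ [n hn0] _] := cartan_h; exists n.
apply/eqP; rewrite -memv0 -hn0 iter_shift0; elim: n {hn0} => //= n IHn.
by rewrite adE; apply: memv_lie_prod.
Qed.

Lemma cartan_gvec y w c v : y \in h -> w \in h ->
  gvec (ad y) c v -> gvec (ad y) c (lie w v).
Proof.
move=> yh wh vc; have := gvec_rep (rho := adjoint g) (cartan_ad_nilpotent yh wh) vc.
by rewrite add0r /= adE.
Qed.

(** Engel's theorem for [h] acting on the generalized null vectors modulo [h].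
    A nonzero class killed by an ideal [K] of [h] yields one killed by a
    larger ideal [K + <[x]>], with [x] found in the last term of the lower
    central series not inside [K]: apply [x] as often as the class stays
    nonzero.  A class killed by all of [h] contradicts self-normalization. *)
Lemma cartan_engel v :
  (forall y, y \in h -> gvec (ad y) 0 v) -> v \in h.
Proof.
have [_ [n hn0] selfnorm] := cartan_h.
pose nilp u := forall y, y \in h -> gvec (ad y) 0 u.
move=> nv; apply/negP => /negP vh.
suff [u [uh hu]] : exists u, u \notin h /\ forall x, x \in h -> lie x u \in h.
  case/negP: uh; apply: selfnorm => y yh.
  by rewrite lie_anti memvN; apply: hu.
(* Induction on the codimension in h of an ideal K of h killing a class. *)
suff: forall m (K : {vspace g}), (\dim h - \dim K <= m)%N -> (K <= h)%VS ->
    (forall x y, x \in h -> y \in K -> lie x y \in K) ->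
    (exists u, [/\ nilp u, u \notin h & forall x, x \in K -> lie x u \in h]) ->
    exists u, u \notin h /\ forall x, x \in h -> lie x u \in h.
  move/(_ _ 0%VS (leqnn _) (sub0v _)); apply => [x y _|].
    by rewrite memv0 => /eqP ->; rewrite linear0 mem0v.
  by exists v; split=> // x; rewrite memv0 => /eqP ->; rewrite lie0l mem0v.
elim=> [|m IHm] K leKm Kh Kid [u [nu uh Ku]].
  have /eqP EK : K == h by rewrite eqEdim Kh -subn_eq0 -leqn0.
  by exists u; split=> // x; rewrite -{1}EK; apply: Ku.
have [hK|/subvPn [x0 x0h x0K]] := boolP (h <= K)%VS.
  by exists u; split=> // x /(subvP hK); apply: Ku.
have [x [xh xK hx]] : exists x, [/\ x \in h, x \notin K &
    forall y, y \in h -> lie y x \in K].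
  have: (lower_central h n <= K)%VS by rewrite hn0 sub0v.
  elim: n {hn0} => [|p IHp] /= lcK; first by rewrite (subvP lcK) in x0K.
  have [/IHp //|/subvPn [x xlc xK]] := boolP (lower_central h p <= K)%VS.
  exists x; split=> //; first by apply: (subvP (lower_central_sub p)).
  by move=> y yh; apply/(subvP lcK)/memv_lie_prod.
have xKP z : z \in (K + <[x]>)%VS -> exists2 k, k \in K & exists a, z = k + a *: x.
  by case/memv_addP => k kK [_ /vlineP [a ->] ->]; exists k => //; exists a.
apply: (IHm (K + <[x]>)%VS).
- have ltK := dimv_add_line xK.
  rewrite -ltnS; apply: leq_trans leKm; apply: ltn_sub2l => //.
  apply: leq_trans ltK (dimvS _); rewrite subv_add Kh /=.
  by apply/subvP => _ /vlineP [a ->]; apply: memvZ.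
- by rewrite subv_add Kh /=; apply/subvP => _ /vlineP [a ->]; apply: memvZ.
- move=> y z yh /xKP [k kK [a ->]]; apply: (subvP (addvSl _ _)).
  by rewrite lieDr lieZr; apply: memvD; [apply: Kid | apply/memvZ/hx].
pose w j := iter j (ad x) u.
have wP j : nilp (w j) /\ forall y, y \in K -> lie y (w j) \in h.
  elim: j => // j [nw Kw]; rewrite /w /= -/(w j) adE; split=> [y yh|y yK].
    by apply: cartan_gvec => //; apply: nw.
  have := @rep_commute _ _ _ (adjoint g) y x (w j); rewrite /= !adE => ->.
  apply: memvD; last by apply/Kw; rewrite lie_anti memvN Kid.
  by apply: cartan_lie => //; apply: Kw.
have [p wp] : exists p, w p = 0.
  by have [p] := nu x xh; rewrite iter_shift0; exists p.
have [j [wj wSj]] : exists j, w j \notin h /\ w j.+1 \in h.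
  have {wp} : w p \in h by rewrite wp mem0v.
  elim: p => [|p IHp] wp; first by rewrite [w 0]/= (negPf uh) in wp.
  by have [/IHp //|wph] := boolP (w p \in h); exists p.
have [nw Kw] := wP j.
exists (w j); split=> // y /xKP [k kK [a ->]].
rewrite lieDl lieZl; apply: memvD; first exact: Kw.
by apply: memvZ; move: wSj; rewrite /w /= adE.
Qed.

(** Otherwise the radical of the form, an ideal, is everything.  For every [y],
    with [S] the conjugate of the semisimple part of [ad y], the trace of
    [ad y S] vanishes: [y] is a sum of brackets, and as [S] is a derivation the
    trace is a value of the Killing form for each of them.  So all [ad y] are
    nilpotent, [h = g] by Engel's theorem, and [g], equal to its derived
    algebra, would be nilpotent. *)
Lemma killing_nondegenerate x : (forall y, killing x y = 0) -> x = 0.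
Proof.
have [|a u v u0 v0 y|u v v0 y|H|kill0] :=
    @simple_lie_ideal (fun x => forall y, killing x y = 0).
- by move=> y; apply: killing0l.
- by rewrite killing_linearl u0 v0 mulr0 addr0.
- by rewrite lie_anti killingNl killing_lie v0 oppr0.
- exact: H.
have nil y : nilpotent_lfun (ad y).
  have [S SP] := semisimple_part (fun c => c^*) (ad y).
  apply: (conj_trace_nilpotent SP).
  apply: (@lie_span (fun y => lftrace (ad y \o S)%VF = 0)).
  - by rewrite linear0 comp_lfun0l linear0.
  - move=> a u v u0 v0.
    by rewrite linearP comp_lfunDl -comp_lfunZl linearP /= u0 v0 mulr0 addr0.
  move=> u v; rewrite ad_lie trace_lie.
  have -> : ((ad v \o S) - (S \o ad v))%VF = - ad (S v).
    apply/lfunP => w; rewrite add_lfunE !opp_lfunE !comp_lfunE !adE.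
    rewrite (semisimple_derivation _ SP) => [|a b]; last exact: rmorphD.
    by rewrite opprD addrCA subrr addr0.
  by rewrite comp_lfunNr linearN /= -/(killing _ _) kill0 oppr0.
have hfull : h = fullv.
  apply/eqP; rewrite eqEsubv subvf; apply/subvP => v _.
  by apply: cartan_engel => y _; apply: nil.
have [_ [n hn0] _] := cartan_h.
have lc m : lower_central h m = fullv.
  by elim: m => [|m IHm] //=; rewrite IHm hfull lie_full.
move=> _; apply/eqP; rewrite -memv0.
suff -> : 0%VS = fullv :> {vspace g} by apply: memvf.
by rewrite -hn0 lc.
Qed.

(** Let [z] represent the functional that sends [y] to the trace of [D ad y].
    Then [E = D - ad z] has zero trace against every [ad y], hence [E v] is
    orthogonal to [g] since [ad (E v)] is the commutator of [E] and [ad v]. *)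
Lemma derivation_inner (D : 'End(g)) :
    (forall u v, D (lie u v) = lie (D u) v + lie u (D v)) ->
  exists z, forall v, D v = lie z v.
Proof.
move=> derD.
have [||z _ zP] := functional_represented (f := fun y => lftrace (D \o ad y)%VF)
  (@killing_linearl _ g) (@killing_linearr _ g) (U := fullv).
- by move=> z _ z0; apply: killing_nondegenerate => y; apply/z0/memvf.
- by move=> a u v; rewrite linearP comp_lfunDr -comp_lfunZr linearP.
exists z => v; pose E := D - ad z.
have trE y : lftrace (E \o ad y)%VF = 0.
  by rewrite comp_lfunDl comp_lfunNl linearB /= -zP ?memvf // subrr.
have EE u : E u = D u - lie z u by rewrite add_lfunE opp_lfunE adE.
clearbody E; have derE u w : E (lie u w) = lie (E u) w + lie u (E w).
  have := @rep_commute _ _ _ (adjoint g) z u w; rewrite /= !adE => zuw.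
  rewrite !EE derD zuw lieBl lieBr (addrC (lie u (lie z w))) opprD.
  by rewrite addrACA.
suff : E v = 0 by rewrite EE => /eqP; rewrite subr_eq0 => /eqP.
apply: killing_nondegenerate => y.
have -> : killing (E v) y = lftrace (((E \o ad v) - (ad v \o E)) \o ad y)%VF.
  congr (lftrace (_ \o _)%VF); apply/lfunP => w.
  by rewrite add_lfunE opp_lfunE !comp_lfunE !adE derE addrK.
by rewrite trace_lie -ad_lie trE.
Qed.

(** Such a [z] is orthogonal to [g].  The latter is spanned by joint generalized
    eigenvectors [v] of [h].  If one of the eigenvalues is nonzero, [v] is in the
    image of some [ad w], and invariance of the form with [[z, w] = 0] applies;
    otherwise [v] is in [h], and [ad z ad v] is nilpotent. *)
Lemma cartan_central_nilpotent z :
    (forall y, y \in h -> lie z y = 0) -> nilpotent_lfun (ad z) -> z = 0.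
Proof.
move=> zh nz; apply: killing_nondegenerate => y.
have [|a u v u0 v0|W WP] := @linear_pred_vspace _ _ (fun y => killing z y = 0).
- exact: killing0r.
- by rewrite killing_linearr u0 v0 mulr0 addr0.
apply/WP; suff sW : (fullv <= W)%VS by apply: (subvP sW); apply: memvf.
apply: (@joint_gvec_span _ _ (fun X => exists2 w, w \in h & X = ad w)).
- move=> X Y c v [w wh ->] [w' w'h ->]; rewrite adE; exact: cartan_gvec.
- by move=> X _ v _; apply: memvf.
move=> v _ vP; apply/WP.
have [[w [wh [c [c0 vc]]]]|nex] := classic (exists w, w \in h /\
    exists c, c != 0 /\ gvec (ad w) c v).
  have [u ->] := gvec_image c0 vc.
  by rewrite adE -killing_lie zh // killing0l.
have vh : v \in h.
  apply: cartan_engel => w wh; have [|c vc] := vP (ad w); first by exists w.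
  have [<- //|c0] := eqVneq c 0; case: nex; exists w; split=> //.
  by exists c.
apply/nilpotent_trace/nilpotent_comm => // w.
by have := @rep_commute _ _ _ (adjoint g) z v w; rewrite /= !adE (zh v vh) lie0l addr0.
Qed.

(** The trace of [ad a ad b - ad b ad a] against an operator commuting with
    [ad b] is zero, and the conjugate of the semisimple part of [ad z] is one
    because [b] commutes with [z]. *)
Lemma cartan_abelian_step z : z \in lie_prod h h ->
  (forall y, y \in h -> lie y z = 0) -> z = 0.
Proof.
move=> zhh hz; apply: cartan_central_nilpotent => [y yh|].
  by rewrite lie_anti hz ?oppr0.
have [S SP] := semisimple_part (fun c => c^*) (ad z).
apply: (conj_trace_nilpotent SP).
have [|a u v u0 v0|W WP] := @linear_pred_vspace _ _ (fun y => lftrace (ad y \o S)%VF = 0).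
- by rewrite linear0 comp_lfun0l linear0.
- by rewrite linearP comp_lfunDl -comp_lfunZl linearP /= u0 v0 mulr0 addr0.
apply/WP; apply: subvP zhh; apply/lie_prodP => a b ah bh; apply/WP.
rewrite ad_lie trace_lie.
suff -> : (ad b \o S)%VF = (S \o ad b)%VF by rewrite subrr comp_lfun0r linear0.
apply/esym/(semisimple_comm SP) => c v vc; rewrite adE; apply: gvec_comm vc => [u|].
  rewrite !shiftE !adE linearB linearZ /=; congr (_ - _).
  by have := @rep_commute _ _ _ (adjoint g) b z u; rewrite /= !adE (hz b bh) lie0l addr0.
exact: linear0.
Qed.

(** The last nonzero term of the lower central series is central, so by
    [cartan_abelian_step] it cannot lie in the derived algebra. *)
Lemma cartan_abelian x y : x \in h -> y \in h -> lie x y = 0.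
Proof.
move=> xh yh; apply/eqP; rewrite -memv0; have [_ [n hn0] _] := cartan_h.
suff <- : lower_central h 1 = 0%VS by apply: memv_lie_prod.
have: lower_central h n.+1 = 0%VS.
  apply/eqP; rewrite -subv0 /= hn0; apply/lie_prodP => u v _.
  by rewrite memv0 => /eqP ->; rewrite linear0 mem0v.
elim: n {hn0} => // n IHn lc0; apply: IHn.
apply/eqP; rewrite -subv0; apply/subvP => z zlc; rewrite memv0; apply/eqP.
apply: cartan_abelian_step => [|w wh].
  move: zlc; apply: subvP; apply/lie_prodP => u v uh vlc.
  by apply: memv_lie_prod => //; apply: (subvP (lower_central_sub n)).
by apply/eqP; rewrite -memv0 -lc0; apply: memv_lie_prod.
Qed.

Lemma cartan_centralizer x : (forall y, y \in h -> lie y x = 0) -> x \in h.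
Proof.
move=> hx; have [_ _] := cartan_h; apply=> y yh.
by rewrite lie_anti hx // oppr0 mem0v.
Qed.

(** The semisimple part of [ad y] is [ad s] for some [s], as a derivation.  It
    vanishes on [h], so [s] is in [h]; then [y - s] is a central element of [h]
    with nilpotent adjoint action. *)
Lemma cartan_semisimple y c v : y \in h -> gvec (ad y) c v -> lie y v = c *: v.
Proof.
move=> yh vc; have [S SP] := semisimple_part (fun c => c) (ad y).
have [|s sP] := @derivation_inner S.
  exact: (semisimple_derivation _ SP).
have sh w : w \in h -> lie w s = 0.
  move=> wh; rewrite lie_anti -sP (SP 0) ?scale0r ?oppr0 //.
  exact: cartan_ad_nilpotent.
have ysh : y - s \in h by rewrite memvB // cartan_centralizer.
have adS : ad (y - s) = ad y - S.
  by apply/lfunP => w; rewrite linearB !add_lfunE !opp_lfunE adE sP adE.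
have ys0 : y - s = 0.
  apply: cartan_central_nilpotent => [w wh|]; first exact: cartan_abelian.
  by rewrite adS; apply: nilpotent_part.
by rewrite -(SP _ _ vc) sP; congr lie; apply/eqP; rewrite -subr_eq0 ys0.
Qed.

End Cartan.
End SimpleLie.

(** * Commutators with a representation *)

Section CommutatorRepresentation.

Variables (F : numClosedFieldType) (g : lieAlgType F) (V : vectType F).
Variable rho : representation g V.
Implicit Types (x y : g) (b : 'End(V)).

Definition commutator x b : 'End(V) := (rho x \o b)%VF - (b \o rho x)%VF.

Lemma commutatorE x b v : commutator x b v = rho x (b v) - b (rho x v).
Proof. by rewrite add_lfunE opp_lfunE !comp_lfunE. Qed.

Fact commutator_is_linear x : linear (commutator x).
Proof.
move=> a b b'; apply/lfunP => v.
rewrite commutatorE [RHS]add_lfunE [in RHS]scale_lfunE !commutatorE.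
by rewrite !add_lfunE !scale_lfunE lfunD lfunZ scalerBr opprD addrACA.
Qed.
HB.instance Definition _ x :=
  GRing.isLinear.Build F 'End(V) 'End(V) *:%R (commutator x)
    (commutator_is_linear x).

Definition commutator_lfun x : 'End('End(V)) := linfun (commutator x).

Lemma commutator_lfunE x b v :
  commutator_lfun x b v = rho x (b v) - b (rho x v).
Proof. by rewrite -commutatorE [commutator_lfun x b]lfunE. Qed.

Fact commutator_lfun_is_linear : linear commutator_lfun.
Proof.
move=> a x y; apply/lfunP => b; apply/lfunP => v.
rewrite commutator_lfunE add_lfunE scale_lfunE [RHS]add_lfunE [in RHS]scale_lfunE.
rewrite !commutator_lfunE !repD !repZ.
by rewrite lfunD lfunZ scalerBr opprD addrACA.
Qed.
HB.instance Definition _ :=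
  GRing.isLinear.Build F g 'End('End(V)) *:%R commutator_lfun
    commutator_lfun_is_linear.

Fact commutator_lie x y : commutator_lfun (lie x y) =
  (commutator_lfun x \o commutator_lfun y)%VF -
  (commutator_lfun y \o commutator_lfun x)%VF.
Proof.
apply/lfunP => b; apply/lfunP => v.
rewrite commutator_lfunE add_lfunE opp_lfunE !comp_lfunE.
rewrite add_lfunE opp_lfunE !commutator_lfunE !rep_lieE !lfunB.
rewrite !opprB [RHS]addrACA !subrKA addrACA [RHS]addrACA.
by congr (_ + _); apply: addrC.
Qed.

Definition commutator_rep : representation g 'End(V) :=
  Representation commutator_lie.

Lemma commutator_comp x (a b : 'End(V)) : commutator_rep x (a \o b)%VF =
  (commutator_rep x a \o b)%VF + (a \o commutator_rep x b)%VF.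
Proof.
apply/lfunP => v; rewrite add_lfunE [RHS]/= !comp_lfunE !commutator_lfunE.
by rewrite !comp_lfunE lfunB addrA subrK.
Qed.

Lemma commutator_trace x (b : 'End(V)) : lftrace (commutator_rep x b) = 0.
Proof. by rewrite [commutator_rep _ _]lfunE linearB /= lftraceC subrr. Qed.

End CommutatorRepresentation.

(** * Weight vectors and simple modules *)

Section WeightVectors.

Variables (F : numClosedFieldType) (g : lieAlgType F) (h : {vspace g}).
Hypotheses (simple_g : is_simple_lie g) (cartan_h : is_cartan h).
Implicit Types (x y z e f : g).

(** The weight is left implicit: an eigenvalue for each element of [h]. *)
Definition weight_vector (V : vectType F) (rho : representation g V) (v : V) :=
  forall y, y \in h -> exists c, rho y v = c *: v.

(** Stated with generalized eigenvectors, semisimplicity passes to stable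
    subspaces at no cost. *)
Definition cartan_acts_semisimply (V : vectType F) (rho : representation g V) :=
  forall y c v, y \in h -> gvec (rho y) c v -> rho y v = c *: v.

Lemma weight_vector_span (V : vectType F) (rho : representation g V)
    (U W : {vspace V}) :
    cartan_acts_semisimply rho ->
    (forall y v, y \in h -> v \in U -> rho y v \in U) ->
    (forall v, v \in U -> weight_vector rho v -> v \in W) ->
  (U <= W)%VS.
Proof.
move=> ss hU UW.
apply: (@joint_gvec_span _ _ (fun X => exists2 y, y \in h & X = rho y)).
- move=> _ _ c v [y yh ->] [w wh ->] vc; rewrite -[c]add0r.
  apply: gvec_rep vc; apply: eig_gvec.
  by rewrite adE scale0r; apply: (cartan_abelian simple_g cartan_h).
- by move=> _ [y yh ->] v; apply: hU.
move=> v vU vc; apply: UW => // y yh.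
by have [|c /(ss _ _ _ yh) Ev] := vc (rho y); [exists y | exists c].
Qed.

Lemma adjoint_semisimple : cartan_acts_semisimply (adjoint g).
Proof.
by move=> y c v yh vc; rewrite /= adE; apply: (cartan_semisimple simple_g cartan_h).
Qed.

Lemma killing_partner e : e != 0 ->
  exists f, weight_vector (adjoint g) f /\ killing e f != 0.
Proof.
move=> e0; apply: NNPP => nf; case/eqP: e0.
apply: (killing_nondegenerate simple_g cartan_h) => y.
have [|a u v u0 v0|W WP] := @linear_pred_vspace _ _ (fun y => killing e y = 0).
- exact: killing0r.
- by rewrite killing_linearr u0 v0 mulr0 addr0.
apply/WP; suff sW : (fullv <= W)%VS by apply: (subvP sW); apply: memvf.
apply: (weight_vector_span adjoint_semisimple) => [w v _ _|f _ wf].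
  exact: memvf.
by apply/WP/eqP; apply: contra_notT nf => ef; exists f.
Qed.

Lemma killing_weights e f y a b : lie y e = a *: e -> lie y f = b *: f ->
  killing e f != 0 -> b = - a.
Proof.
move=> ye yf; have := killing_lie e y f; rewrite lie_anti ye yf.
rewrite -scaleNr killingZl killingZr => E ef0.
by apply: (mulIf ef0); rewrite -E.
Qed.

(** If the eigenvalue [c] of [H = [e, f]] on [e] were zero, [ad f] would commute
    with [ad H], hence with the conjugate of its semisimple part; so [ad H],
    a commutator, would be nilpotent and [H] zero.  But by invariance [H] is
    not orthogonal to [y0]. *)
Lemma root_pair e f y0 c0 : weight_vector (adjoint g) e ->
    weight_vector (adjoint g) f -> y0 \in h -> c0 != 0 -> lie y0 e = c0 *: e ->
    killing e f != 0 ->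
  lie e f \in h /\ exists2 c, c != 0 & lie (lie e f) f = - c *: f.
Proof.
move=> we wf y0h c00 y0e ef0.
have wt y : y \in h -> exists2 a, lie y e = a *: e & lie y f = - a *: f.
  move=> yh; have [a /= ] := we y yh; have [b /=] := wf y yh; rewrite !adE.
  by move=> yf ye; exists a => //; rewrite -(killing_weights ye yf).
have Hh : lie e f \in h.
  apply: (cartan_centralizer cartan_h) => y yh; have [a ye yf] := wt y yh.
  have := @rep_commute _ _ _ (adjoint g) y e f; rewrite /= !adE => ->.
  by rewrite ye yf lieZl lieZr scaleNr addNr.
split=> //; have [c He Hf] := wt _ Hh; exists c => //.
apply/negP => /eqP c_0; rewrite c_0 oppr0 !scale0r in He Hf.
have [a y0e' y0f] := wt _ y0h.
have Ey0f : lie f y0 = a *: f by rewrite lie_anti y0f scaleNr opprK.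
have e0 : e != 0.
  by apply: contra ef0 => /eqP ->; rewrite killing0l.
have a0 : a != 0.
  apply: contra c00 => /eqP a0; move/eqP: y0e'; rewrite y0e a0 scale0r.
  by rewrite scaler_eq0 (negPf e0) orbF.
suff H0 : lie e f = 0.
  have := killing_lie e f y0; rewrite H0 Ey0f killing0l killingZr => /esym/eqP.
  by rewrite mulf_eq0 (negPf a0) (negPf ef0).
apply: (cartan_central_nilpotent simple_g cartan_h) => [y yh|].
  exact: (cartan_abelian simple_g cartan_h).
have [S SP] := semisimple_part (fun c => c^*) (ad (lie e f)).
apply: (conj_trace_nilpotent SP); rewrite {1}ad_lie trace_lie.
suff -> : (ad f \o S)%VF = (S \o ad f)%VF by rewrite subrr comp_lfun0r linear0.
apply/esym/(semisimple_comm SP) => d v vd; rewrite -[d]add0r.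
apply: (gvec_rep (rho := adjoint g)) vd; apply: eig_gvec.
by rewrite adE Hf scale0r.
Qed.

Section SimpleModule.

Variables (V : vectType F) (rho : representation g V).
Hypothesis simple_V : is_simple_module rho.

Lemma simple_submodule (P : V -> Prop) v0 :
    P 0 -> (forall a u v, P u -> P v -> P (a *: u + v)) ->
    (forall x v, P v -> P (rho x v)) -> v0 != 0 -> P v0 ->
  forall v, P v.
Proof.
move=> P0 PD Prho v00 Pv0; have [W WP] := linear_pred_vspace P0 PD.
have [_ /(_ W) []] := simple_V.
- move=> x _; apply/subvP => _ /memv_imgP [v vW ->].
  by apply/WP/Prho/WP.
- by move=> W0; move/WP: Pv0; rewrite W0 memv0 (negPf v00).
by move=> Wf v; apply/WP; rewrite Wf memvf.
Qed.

Lemma schur (b : 'End(V)) : (forall x v, rho x (b v) = b (rho x v)) ->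
  exists c, b = c *: \1%VF.
Proof.
move=> bV; have sb : stable_under b fullv by move=> v _; apply: memvf.
have [c [v0 [_ v00 bv0]]] := eigenvector_exists sb simple_V.1.
exists c; apply/lfunP; move=> v; rewrite scale_lfunE id_lfunE; move: v.
apply: (@simple_submodule _ v0) => // [|a u v bu bv|x v bv].
- by rewrite lfun0 scaler0.
- by rewrite lfunD lfunZ bu bv scalerDr !scalerA mulrC.
by rewrite -bV bv lfunZ.
Qed.

(** The nilpotent part [N] of [rho y] commutes with [g]: on a root vector [e],
    [rho y] and its semisimple part have the same commutator with [rho e].  By
    Schur's lemma, [N] is a nilpotent scalar. *)
Lemma simple_module_semisimple : cartan_acts_semisimply rho.
Proof.
move=> y c v yh vc; have [S SP] := semisimple_part (fun c => c) (rho y).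
pose N := rho y - S.
have NE u : N u = rho y u - S u by rewrite add_lfunE opp_lfunE.
have nN : nilpotent_lfun N by apply: nilpotent_part.
clearbody N.
have [|d Nd] := @schur N.
  move=> x u.
  have [||W WP] := @linear_pred_vspace _ _ (fun x => rho x (N u) = N (rho x u)).
  - by rewrite !rep0 lfun0.
  - by move=> a x1 x2 N1 N2; rewrite !repD !repZ lfunD lfunZ N1 N2.
  apply/WP; suff sW : (fullv <= W)%VS by apply: (subvP sW); apply: memvf.
  apply: (weight_vector_span adjoint_semisimple) => [w z _ _|e _ we].
    exact: memvf.
  apply/WP; have [d /=] := we y yh; rewrite adE => ye.
  suff : (S \o rho e = (rho e \o S) + d *: rho e)%VF.
    move/lfunP/(_ u); rewrite add_lfunE scale_lfunE !comp_lfunE => Se.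
    by rewrite !NE Se rep_commute ye repZ lfunB opprD addrACA subrr addr0.
  apply: (gvec_lfunP (X := rho y)) => a w wa.
  rewrite add_lfunE scale_lfunE !comp_lfunE (SP _ _ wa) lfunZ -scalerDl addrC.
  by apply: SP; apply: gvec_rep => //; apply: eig_gvec; rewrite adE.
have [v0 _ v00] : exists2 v0 : V, v0 \in {:V}%VS & v0 != 0.
  have := simple_V.1; rewrite -subv0 => /subvPn [v0 v0f].
  by rewrite memv0; exists v0.
have d0 : d = 0.
  by apply: (nilpotent_eig nN v00); rewrite Nd scale_lfunE id_lfunE.
move: (NE v); rewrite Nd d0 scale0r zero_lfunE => /esym/eqP.
by rewrite subr_eq0 (SP _ _ vc) => /eqP.
Qed.

Lemma commutator_semisimple : cartan_acts_semisimply (commutator_rep rho).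
Proof.
move=> y d b yh [k bk]; apply: (gvec_lfunP (X := rho y)) => c v vc.
rewrite scale_lfunE commutator_lfunE.
have yv := simple_module_semisimple yh vc.
rewrite yv lfunZ.
suff ybv : gvec (rho y) (c + d) (b v).
  by rewrite (simple_module_semisimple yh ybv) scalerDl addrC addKr.
exists k; suff E j : iter j (shift (rho y) (c + d)) (b v) =
    iter j (shift (commutator_rep rho y) d) b v by rewrite E bk zero_lfunE.
elim: j => //= j ->; move: (iter _ _ b) => b'.
rewrite !shiftE add_lfunE opp_lfunE scale_lfunE commutator_lfunE yv lfunZ.
by rewrite scalerDl opprD addrA.
Qed.

End SimpleModule.

End WeightVectors.

(** * Indecomposability over a subspace normalized by the Cartan subalgebra *)

Section Wide.

Variables (F : numClosedFieldType) (g : lieAlgType F) (h s : {vspace g}).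
Hypotheses (simple_g : is_simple_lie g) (cartan_h : is_cartan h).
Hypothesis hs : forall y x, y \in h -> x \in s -> lie y x \in s.
Hypothesis adjoint_indec : is_indecomposable (adjoint g) s.
Variables (V : vectType F) (rho : representation g V).
Hypothesis simple_V : is_simple_module rho.

Lemma cartan_neq0 : h != 0%VS.
Proof.
apply/negP => /eqP h0; have [_ _ selfnorm] := cartan_h.
case/negP: simple_g.1; rewrite -subv0; apply/lie_prodP => x y _ _.
rewrite -h0; apply: selfnorm => z; rewrite h0 memv0 => /eqP ->.
by rewrite linear0 mem0v.
Qed.

(** The centralizer [S] of [b] is all of [g], because it is a direct summand of
    the adjoint module over [s], with complement its orthogonal [S']. *)
Lemma cartan_invariant_scalar (b : 'End(V)) :
    (forall y, y \in h -> commutator_rep rho y b = 0) ->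
    (forall x, x \in s -> commutator_rep rho x b = 0) ->
  exists c, b = c *: \1%VF.
Proof.
move=> hb sb.
have [||S SP] := @linear_pred_vspace _ _ (fun x => commutator_rep rho x b = 0).
- exact: rep0.
- by move=> a x y xb yb; rewrite repD repZ xb yb scaler0 addr0.
have Slie x y : x \in S -> y \in S -> lie x y \in S.
  by move=> /SP xb /SP yb; apply/SP; rewrite rep_lieE xb yb !lfun0 subrr.
have [||S' S'P] := @linear_pred_vspace _ _
    (fun z => forall x, x \in S -> killing z x = 0).
- by move=> x _; apply: killing0l.
- by move=> a u v u0 v0 x xS; rewrite killing_linearl u0 // v0 // mulr0 addr0.
have S'lie x z : x \in S -> z \in S' -> lie x z \in S'.
  move=> xS /S'P zS'; apply/S'P => y yS.
  by rewrite killingC -killing_lie killingC zS' //; apply: Slie.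
have hS y : y \in h -> y \in S by move=> yh; apply/SP/hb.
have sS x : x \in s -> x \in S by move=> xs; apply/SP/sb.
have disj : (S :&: S' = 0)%VS.
  apply/eqP; rewrite -subv0.
  apply: (weight_vector_span simple_g cartan_h (adjoint_semisimple simple_g cartan_h)).
    move=> y v yh; rewrite /= adE !memv_cap => /andP[vS vS'].
    by rewrite Slie ?S'lie // hS.
  (* A root vector of S has a partner in S that is not orthogonal to it. *)
  move=> e; rewrite memv_cap memv0 => /andP[eS eS'] we; apply/negP => /negP e0.
  have [f [wf ef]] := killing_partner simple_g cartan_h e0.
  case/eqP: (ef); apply: (S'P _).1 => //.
  have [[y0 [y0h [c0 c00 y0e]]]|ne] := classic (exists y0, y0 \in h /\
      exists2 c0, c0 != 0 & lie y0 e = c0 *: e).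
    have [Hh [c c_n0 Hf]] := root_pair simple_g cartan_h we wf y0h c00 y0e ef.
    by apply/SP/(sl2_weight0 c_n0 Hf); [apply/SP | apply: hb].
  apply/hS/(cartan_centralizer cartan_h) => y yh.
  have [a /= ya] := we y yh; have [d /= yf] := wf y yh; rewrite !adE in ya yf.
  have a0 : a = 0.
    by apply/eqP; apply: contra_notT ne => a0; exists y; split=> //; exists a.
  by rewrite yf (killing_weights ya yf ef) a0 oppr0 scale0r.
have sum : (S + S' = fullv)%VS.
  apply/eqP; rewrite eqEsubv subvf; apply/subvP => v _.
  have [z zS|z zS zP] := functional_represented (@killing_linearl _ g)
    (@killing_linearr _ g) (U := S) _ (killing_linearr v).
    move=> z0; apply/eqP; rewrite -memv0 -disj memv_cap zS.
    by apply/S'P.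
  rewrite -(subrKC z v); apply: memv_add => //; apply/S'P => x xS.
  by rewrite killingBl zP // subrr.
have S'0 : S' = 0%VS.
  apply/eqP; apply/negP => /negP S'0; apply: adjoint_indec; exists S, S'; split=> //.
    split=> x xs; apply/subvP => _ /memv_imgP [z zS ->]; rewrite /= adE.
      by apply: Slie => //; apply: sS.
    by apply: S'lie => //; apply: sS.
  apply: contra cartan_neq0 => /eqP S0; rewrite -subv0; apply/subvP => y yh.
  by rewrite -S0; apply: hS.
rewrite S'0 addv0 in sum.
apply: (schur simple_V) => x v; apply/eqP; rewrite -subr_eq0 -commutator_lfunE.
by rewrite (SP x).1 ?sum ?memvf // zero_lfunE.
Qed.

Definition intertwiner (b : 'End(V)) :=
  forall x, x \in s -> commutator_rep rho x b = 0.

Lemma intertwiner_comp a b :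
  intertwiner a -> intertwiner b -> intertwiner (a \o b)%VF.
Proof.
move=> sa sb x xs.
by rewrite commutator_comp sa // sb // comp_lfun0l comp_lfun0r addr0.
Qed.

Lemma intertwiner_cartan y b :
  y \in h -> intertwiner b -> intertwiner (commutator_rep rho y b).
Proof.
move=> yh sb x xs; rewrite rep_commute sb // lfun0 add0r.
by rewrite lie_anti linearN opp_lfunE sb ?oppr0 ?hs.
Qed.

Lemma intertwiner_vspace :
  exists A : {vspace 'End(V)}, forall b, b \in A <-> intertwiner b.
Proof.
apply: linear_pred_vspace => [x _|a b b' sb sb' x xs]; first exact: lfun0.
by rewrite lfunD lfunZ sb // sb' // scaler0 addr0.
Qed.

Let weight := weight_vector h (commutator_rep rho).

(** If the weights of [a] and [b] are not opposite, [a b] is a multiple of a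
    commutator with some [w] in [h]; otherwise [a b] and [b a] have weight zero
    and are scalars. *)
Lemma weight_intertwiner_trace0 a b y c :
    intertwiner a -> intertwiner b -> weight a -> weight b ->
    y \in h -> c != 0 -> commutator_rep rho y a = c *: a ->
  lftrace (a \o b)%VF = 0.
Proof.
move=> sa sb wa wb yh c0 ya.
have [[w [wh [d d0 wab]]]|nab] := classic (exists w, w \in h /\
    exists2 d, d != 0 & commutator_rep rho w (a \o b)%VF = d *: (a \o b)%VF).
  by apply: (mulfI d0); rewrite mulr0 -[LHS]linearZ -wab; apply: commutator_trace.
have wab w : w \in h -> commutator_rep rho w (a \o b)%VF = 0 /\
    commutator_rep rho w (b \o a)%VF = 0.
  move=> wh; have [d wd] := wa w wh; have [d' wd'] := wb w wh.
  rewrite !commutator_comp wd wd' -!comp_lfunZl -!comp_lfunZr -!scalerDl.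
  have -> : d' + d = d + d' by rewrite addrC.
  have [->|dd] := eqVneq (d + d') 0; first by rewrite !scale0r.
  case: nab; exists w; split=> //; exists (d + d') => //.
  by rewrite commutator_comp wd wd' -comp_lfunZl -comp_lfunZr -scalerDl.
(* From here on both products have weight zero. *)
have [w wh|k Ek] := cartan_invariant_scalar _ (intertwiner_comp sa sb).
  exact: (wab w wh).1.
have [w wh|k' Ek'] := cartan_invariant_scalar _ (intertwiner_comp sb sa).
  exact: (wab w wh).2.
have Ekk : k = k'.
  have := lftraceC a b; rewrite Ek Ek' !linearZ /= lftrace1.
  by apply: mulIf; rewrite pnatr_eq0 dimv_eq0 simple_V.1.
apply: (mulfI c0); rewrite mulr0 -[LHS]linearZ comp_lfunZl -ya.
rewrite [commutator_rep _ _ _]lfunE /= trace_lie Ek Ek' Ekk subrr.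
by rewrite comp_lfun0r linear0.
Qed.

(** Intertwiners are spanned by weight vectors; those of weight zero are
    scalars, and for the others [c = 0] works. *)
Lemma intertwiner_trace a : intertwiner a ->
  exists c, forall b, intertwiner b -> lftrace (a \o b)%VF = c * lftrace b.
Proof.
move: a; have [A AP] := intertwiner_vspace.
have hA y b : y \in h -> b \in A -> commutator_rep rho y b \in A.
  by move=> yh /AP sb; apply/AP/intertwiner_cartan.
have ssA := commutator_semisimple simple_g cartan_h simple_V.
have [||J JP] := @linear_pred_vspace _ _ (fun a => exists c, forall b,
    intertwiner b -> lftrace (a \o b)%VF = c * lftrace b).
- by exists 0 => b _; rewrite comp_lfun0l linear0 mul0r.
- move=> k a a' [c cP] [c' c'P]; exists (k * c + c') => b sb.
  by rewrite comp_lfunDl -comp_lfunZl linearP /= cP // c'P // mulrDl mulrA.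
suff AJ : (A <= J)%VS by move=> a /AP/(subvP AJ)/JP.
apply: (weight_vector_span simple_g cartan_h ssA) => // a aA wa; apply/JP.
have sa := (AP a).1 aA.
have [[y [yh [c c0 ya]]]|na] := classic (exists y, y \in h /\
    exists2 c, c != 0 & commutator_rep rho y a = c *: a); last first.
  have [y yh|c ->] := cartan_invariant_scalar _ sa.
    have [c yc] := wa y yh; rewrite yc.
    have [->|c0] := eqVneq c 0; first by rewrite scale0r.
    by case: na; exists y; split=> //; exists c.
  by exists c => b _; rewrite -comp_lfunZl comp_lfun1l linearZ.
exists 0 => b /AP bA; rewrite mul0r.
have [||K KP] := @linear_pred_vspace _ _ (fun b => lftrace (a \o b)%VF = 0).
- by rewrite comp_lfun0r linear0.
- move=> d b1 b2 E1 E2.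
  by rewrite comp_lfunDr -comp_lfunZr linearP /= E1 E2 mulr0 addr0.
apply/KP; apply: subvP bA.
apply: (weight_vector_span simple_g cartan_h ssA) => // {}b /AP sb wb; apply/KP.
exact: weight_intertwiner_trace0 ya.
Qed.

Lemma module_indecomposable : is_indecomposable rho s.
Proof.
move=> [U [W [[sU sW] U0 W0 sumUW dUW]]].
pose e := daddv_pi U W.
have eU u : u \in U -> e u = u by apply: daddv_pi_id.
have eW w : w \in W -> e w = 0.
  move=> wW; apply: (addIr (daddv_pi W U w)); rewrite add0r daddv_pi_add //.
    by rewrite daddv_pi_id // capvC.
  by rewrite sumUW memvf.
have s1 : intertwiner \1%VF.
  move=> x _; apply/lfunP => v.
  by rewrite commutator_lfunE !id_lfunE subrr zero_lfunE.
have se : intertwiner e.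
  move=> x xs; apply/lfunP => v; rewrite commutator_lfunE zero_lfunE.
  have /memv_addP [u uU [w wW ->]] : v \in (U + W)%VS by rewrite sumUW memvf.
  rewrite !lfunD (eU u) // (eW w) // lfun0 addr0.
  rewrite (eW (rho x w)) ?(eU (rho x u)) ?addr0 ?subrr //.
    by apply: (subvP (sU x xs)); apply: memv_img.
  by apply: (subvP (sW x xs)); apply: memv_img.
have ee v : e (e v) = e v by apply/eU/memv_pi.
have [c cP] := intertwiner_trace se.
have tre : lftrace e = c * lftrace e.
  by rewrite -cP //; congr lftrace; apply/lfunP => v; rewrite comp_lfunE ee.
have [tr0|tr0] := eqVneq (lftrace e) 0.
  case/negP: U0; rewrite -subv0; apply/subvP => u uU; rewrite memv0.
  by rewrite -(eU u uU) (idempotent_trace0 ee tr0).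
have c1 : c = 1 by apply: (mulIf tr0); rewrite mul1r -tre.
have tr1 : lftrace (\1%VF - e) = 0.
  by rewrite linearB /= -[e]comp_lfun1r cP // c1 mul1r subrr.
have e'E v : (\1%VF - e) v = v - e v by rewrite add_lfunE opp_lfunE id_lfunE.
case/negP: W0; rewrite -subv0; apply/subvP => w wW; rewrite memv0.
have := e'E w; rewrite (eW w wW) subr0 => <-.
rewrite (idempotent_trace0 _ tr1) // => v.
by rewrite !e'E lfunB ee subrr subr0.
Qed.

End Wide.

(** * Regular subalgebras *)

Lemma regular_subalg_cartan_stable (F : fieldType) (g : lieAlgType F)
    (h t : {vspace g}) (T : {fset dual h}) y :
    (forall x, x \in t -> lie y x \in t) -> y \in h ->
  forall x, x \in regular_subalg T t -> lie y x \in regular_subalg T t.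
Proof.
move=> yt yh x xs.
suff /subvP : (ad y @: regular_subalg T t <= regular_subalg T t)%VS.
  by apply; rewrite -adE memv_img.
rewrite limgD addvS //.
  by apply/subvP => _ /memv_imgP [z zt ->]; rewrite adE yt.
elim/big_ind: _ => [|U W yU yW|a _]; first by rewrite limg0.
  by rewrite limgD addvS.
apply/subvP => _ /memv_imgP [z /rootspaceP za ->].
by rewrite adE -[y](vsprojK yh) za memvZ //; apply/rootspaceP.
Qed.

Lemma adjoint_simple (F : fieldType) (g : lieAlgType F) :
  is_simple_lie g -> is_simple_module (adjoint g).
Proof.
move=> [g0 ideals]; split=> [|U sU].
  by apply: contra g0 => /eqP g0; rewrite -subv0 -g0 subvf.
apply: ideals; apply/lie_prodP => x y _ yU; rewrite -adE.
by apply: (subvP (sU x (memvf x))); apply: memv_img.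
Qed.

Local Open Scope complex_scope.

Theorem corollary3p11 (R : realType) (g : lieAlgType R[i])
    (h : {vspace g}) (T : {fset dual h}) (t : {vspace g}) :
  is_simple_lie g -> is_cartan h -> is_closed T -> (t <= h)%VS ->
  (forall a : dual h, a \in symm_part T ->
     (lie_prod (rootspace a) (rootspace (- a)) <= t)%VS) ->
  is_wide (regular_subalg T t) <->
  is_indecomposable (adjoint g) (regular_subalg T t).
Proof.
move=> simple_g cartan_h _ th _; split=> [wide | indec V rho simple_V].
  exact/wide/adjoint_simple.
apply: (module_indecomposable simple_g cartan_h _ indec simple_V) => y x yh.
apply: regular_subalg_cartan_stable => // z zt.
rewrite (cartan_abelian simple_g cartan_h yh) ?mem0v //.
exact: (subvP th).
Qed.
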